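(* Let $m>1+\sqrt2$ and $b>0$, let $\mathbb H_{m,b}=\{(x,y)\in\mathbb R^2: x^2-\frac{y^2}{m^2}<b^2\}$, and let $\tau_{m,b}=\inf\{t\ge0:\mathbf W(t)\notin\mathbb H_{m,b}\}$ be the first exit time of planar Brownian motion $\mathbf W$ from $\mathbb H_{m,b}$. Then for all $(x,y)\in\mathbb H_{m,b}$, $$\mathbb E_{(x,y)}\left[\tau_{m,b}^2\right]=\frac{\mathbb E_{(x,y)}[\tau_{m,b}]}{3(m^4-6m^2+1)}\left(\frac{m^2(m^2-5)}{m^2-1}\Big((5m^2-1)b^2-(m^2-1)x^2\Big)+(5m^2-1)y^2\right),$$ where $\mathbb E_{(x,y)}[\tau_{m,b}]=\dfrac{m^2(b^2-x^2)+y^2}{m^2-1}$.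
   Context: Planar Brownian motion: $\mathbf W(t)=(W_1(t),W_2(t))$ with independent one-dimensional Brownian coordinates (unit variance per unit time). $\mathbb E_{(x,y)}$ denotes expectation when $\mathbf W$ starts at $(x,y)$. *)

(* Defs.v *)
From HB Require Import structures.
From mathcomp Require Import all_boot all_order all_algebra.
From mathcomp Require Import all_classical all_reals all_analysis.
Import Order.TTheory GRing.Theory Num.Theory.
Import numFieldNormedType.Exports.

Set Implicit Arguments.
Unset Strict Implicit.
Unset Printing Implicit Defensive.

Local Open Scope classical_set_scope.
Local Open Scope ring_scope.

(* Taking some of the A i equal to setT gives the product rule for every
   subfamily of X. *)
Definition mutually_independent {d : measure_display} {T : measurableType d}
    {R : realType} (P : probability T R) (n : nat) (X : 'I_n -> T -> R) : Prop :=
  forall A : 'I_n -> set R, (forall i, measurable (A i)) ->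
    P (\bigcap_(i in [set: 'I_n]) (X i @^-1` A i)) =
    (\prod_(i < n) P (X i @^-1` A i))%E.

(* Processes have time set [0, +oo[: their values at negative indices are
   never used. *)
Definition process_sigma_algebra {d : measure_display} {T : measurableType d}
    {R : realType} (X : R -> T -> R) : set (set T) :=
  <<s \bigcup_(t in [set t : R | 0 <= t])
        preimage_set_system setT (X t) measurable >>.

Definition independent_processes {d : measure_display} {T : measurableType d}
    {R : realType} (P : probability T R) (X Y : R -> T -> R) : Prop :=
  forall A B : set T, process_sigma_algebra X A -> process_sigma_algebra Y B ->
    P (A `&` B) = (P A * P B)%E.

(* The second parameter of normal_prob is the standard deviation. *)
Record brownian_motion {d : measure_display} {T : measurableType d}
    {R : realType} (P : probability T R) (x : R) (W : R -> {RV P >-> R}) :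
    Prop := BrownianMotion {
  bm_start : {ae P, forall w, W 0 w = x};
  bm_independent_increments : forall (n : nat) (t : nat -> R),
    0 <= t 0%N -> (forall i, t i <= t i.+1) ->
    mutually_independent P (fun i : 'I_n => W (t i.+1) \- W (t i));
  bm_gaussian_increments : forall s t : R, 0 <= s -> s < t ->
    forall A : set R, measurable A ->
      P ((W t \- W s) @^-1` A) = normal_prob 0 (Num.sqrt (t - s)) A;
  bm_continuous : forall w : T, {within `[0, +oo[, continuous (fun t => W t w)}
}.

Record planar_brownian_motion {d : measure_display} {T : measurableType d}
    {R : realType} (P : probability T R) (z : R * R)
    (W1 W2 : R -> {RV P >-> R}) : Prop := PlanarBrownianMotion {
  pbm_fst : brownian_motion z.1 W1;
  pbm_snd : brownian_motion z.2 W2;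
  pbm_independent : independent_processes P W1 W2
}.

(* Equal to +oo for a path that never leaves D. *)
Definition exit_time {R : realType} (D : set (R * R)) (path : R -> R * R) :
    \bar R :=
  ereal_inf (EFin @` [set t : R | 0 <= t /\ ~ D (path t)]).

Definition hyperbolic_domain {R : realType} (m b : R) : set (R * R) :=
  [set z | z.1 ^+ 2 - z.2 ^+ 2 / m ^+ 2 < b ^+ 2].

(* Main.v *)
Require Import Defs.
From mathcomp Require Import all_boot all_order all_algebra.
From mathcomp Require Import all_classical all_reals all_analysis.
From mathcomp Require Import measurable_realfun ring lra zify.
Import Order.TTheory GRing.Theory Num.Theory.
Import numFieldNormedType.Exports.
Local Open Scope classical_set_scope.
Local Open Scope ring_scope.

(** Write z for the starting point, u(z) for the claimed mean and
    v(z) for the claimed second moment; both are polynomials in z.  They vanish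
    on the boundary hyperbola, and half their Laplacians are -1 and -2u.  Hence
    u(W_t) + t and v(W_t) + 2 t u(W_t) + t^2 are martingales, and stopping them
    at T = min(tau, K) gives
      E T + E u(W_T) = u(z),
      E T^2 + 2 E (T u(W_T)) + E v(W_T) = v(z).
    It remains to see that the terms in W_T disappear as K grows.  Both u and v
    are nonnegative on the domain (for v this is where m > 1 + sqrt 2 is used),
    so that E T^2 <= v(z).  Let Y be the second coordinate of W.  On the domain
    u, u^2 and v are O(1 + Y^4), and at time T they vanish unless T = K, so it
    is enough to show that E (Y_T^4; T = K) tends to 0.  The martingale
    Y^4 - 6 t Y^2 + 3 t^2 and the bound on E T^2 give a bound on E Y_T^4, and a
    martingale bounded in L^4 is Cauchy in L^4, because
    (a - c)^4 <= 3 (a^4 - c^4 - 4 c^3 (a - c)).  As the events T = K have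
    vanishing probability, the claim follows.  No uniform bound on a moment
    of order above 4 enters, so the argument reaches every slope m above
    1 + sqrt 2.  These limits are [expect_hit_time] and [expect_hit_time_sqr].

    Optional stopping is obtained by discretisation.  On a grid of mesh 2^-N
    the planar motion is a walk with independent Gaussian steps, and a
    polynomial solution of the backward heat equation is exactly a martingale
    along it ([heat_poly_step]); stopping the walk at its first visit to the
    complement gives an exact identity ([stopped_heat]).  The moments of the
    stopped walk are bounded by those of the walk at the final time
    ([stopped_even_le]), which provides the uniform integrability needed to let
    N tend to infinity ([expect_cvg], [optional_stopping]).

    The grid times converge to the first dyadic time at which the path has left
    the domain ([grid_hit_cvg]), and this could be later than tau: a path may
    touch the boundary without crossing it at a dyadic time.  So the result is
    applied to the domains with b replaced by b_n < b, where b_n increases to b.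
    Their dyadic exit times increase to tau along every path ([approach_cvg]),
    and the formulas are continuous in b. *)

(** * Families of random variables with bounded moments *)
Section BoundedMoments.
Context {R : realType} {d : measure_display} {T : measurableType d}
  (P : probability T R).

(** All limits below are limits of polynomials in a few random variables, so
    integrability is never tracked for a single exponent: this class is closed
    under sums and products.  It is indexed by a family because a bound that is
    uniform in the family is what makes it uniformly integrable.  The integral
    is the extended one, so that a bound entails integrability. *)
Definition bounded_moments {I : Type} (F : I -> T -> R) : Prop :=
  (forall i, measurable_fun setT (F i)) /\
  forall n : nat, exists C : R, forall i,
    (\int[P]_w (`|F i w| ^+ n)%:E <= C%:E)%E.

Lemma measurable_EFin (f : T -> R) :
  measurable_fun setT f -> measurable_fun setT (fun w => (f w)%:E).
Proof. by move=> mf; apply/measurable_EFinP. Qed.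

Lemma measurable_normX (f : T -> R) n :
  measurable_fun setT f -> measurable_fun setT (fun w => (`|f w| ^+ n)%:E : \bar R).
Proof.
move=> mf; apply/measurable_EFinP; apply: measurable_funX.
exact: measurableT_comp.
Qed.

Lemma bounded_moments_le {I J} (h : J -> I) (F : I -> T -> R) (G : J -> T -> R) :
  bounded_moments F -> (forall j, measurable_fun setT (G j)) ->
  (forall j w, `|G j w| <= `|F (h j) w|) -> bounded_moments G.
Proof.
move=> [mF bF] mG GF; split=> // n; have [C HC] := bF n; exists C => j.
apply: le_trans (HC (h j)); apply: ge0_le_integral => //.
- exact: measurable_normX.
- exact: measurable_normX.
- by move=> w _; rewrite lee_fin lerXn2r ?nnegrE.
Qed.

Lemma bounded_moments_reindex {I J} (h : J -> I) (F : I -> T -> R) :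
  bounded_moments F -> bounded_moments (fun j => F (h j)).
Proof. by move=> bF; apply: (bounded_moments_le h F _ bF) => // j; case: bF. Qed.

Lemma bounded_momentsN {I} (F : I -> T -> R) :
  bounded_moments F -> bounded_moments (fun i w => - F i w).
Proof.
move=> bF; apply: (bounded_moments_le id F _ bF) => [j|j w].
  by apply: measurableT_comp => //; case: bF.
by rewrite normrN.
Qed.

Lemma bounded_moments_bounded {I} (F : I -> T -> R) (c : R) :
  (forall i, measurable_fun setT (F i)) -> (forall i w, `|F i w| <= c) ->
  bounded_moments F.
Proof.
move=> mF Fc; split=> // n; exists (c ^+ n) => i.
apply: le_trans (_ : \int[P]_w (c ^+ n)%:E <= _)%E; last first.
  by rewrite integral_cst//= probability_setT mule1.
apply: ge0_le_integral => //.
- exact: measurable_normX.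
- by move=> w _; rewrite lee_fin lerXn2r ?nnegrE// (le_trans _ (Fc i w)).
Qed.

Lemma bounded_moments_cst {I} (c : I -> R) (M : R) : (forall i, `|c i| <= M) ->
  bounded_moments (fun i (_ : T) => c i).
Proof. by move=> cM; apply: (bounded_moments_bounded _ M). Qed.

Lemma exprD_le (a b : R) n : 0 <= a -> 0 <= b ->
  (a + b) ^+ n <= 2 ^+ n * (a ^+ n + b ^+ n).
Proof.
move=> a0 b0; wlog ab : a b a0 b0 / a <= b.
  move=> H; case: (leP a b) => [|/ltW] ab; first exact: H.
  by rewrite addrC [_ + b ^+ n]addrC H.
apply: (@le_trans _ _ ((2 * b) ^+ n)).
  by rewrite lerXn2r ?nnegrE ?addr_ge0 ?mulr_ge0//; lra.
by rewrite exprMn ler_pM2l ?exprn_gt0// lerDr exprn_ge0.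
Qed.

Lemma bounded_momentsD {I} (F G : I -> T -> R) :
  bounded_moments F -> bounded_moments G ->
  bounded_moments (fun i w => F i w + G i w).
Proof.
move=> [mF bF] [mG bG]; split=> [i|n]; first exact: measurable_funD.
have [C HC] := bF n; have [D HD] := bG n; exists (2 ^+ n * (C + D)) => i.
apply: le_trans (_ : \int[P]_w (2 ^+ n *
    (`|F i w| ^+ n + `|G i w| ^+ n))%:E <= _)%E.
  apply: ge0_le_integral => //.
  - by apply: measurable_normX; exact: measurable_funD.
  - apply: measurable_EFin; apply: measurable_funM => //.
    by apply: measurable_funD; apply/measurable_EFinP/measurable_normX.
  - move=> w _; rewrite lee_fin.
    apply: le_trans (exprD_le _ _ _ (normr_ge0 _) (normr_ge0 _)).
    by rewrite lerXn2r ?nnegrE ?addr_ge0// ler_normD.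
under eq_integral do rewrite EFinM.
rewrite ge0_integralZl//=; last first.
  apply: measurable_EFin; apply: measurable_funD;
    by apply/measurable_EFinP/measurable_normX.
under eq_integral do rewrite EFinD.
rewrite ge0_integralD//=; last 2 first.
- exact: measurable_normX.
- exact: measurable_normX.
rewrite EFinM EFinD; apply: lee_wpmul2l; last exact: leeD.
by rewrite lee_fin exprn_ge0.
Qed.

Lemma bounded_momentsM {I} (F G : I -> T -> R) :
  bounded_moments F -> bounded_moments G ->
  bounded_moments (fun i w => F i w * G i w).
Proof.
move=> [mF bF] [mG bG]; split=> [i|n]; first exact: measurable_funM.
have [C HC] := bF (n + n)%N; have [D HD] := bG (n + n)%N; exists (C + D) => i.
apply: le_trans (_ : \int[P]_w (
    `|F i w| ^+ (n + n) + `|G i w| ^+ (n + n))%:E <= _)%E.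
  apply: ge0_le_integral => //.
  - by apply: measurable_normX; exact: measurable_funM.
  - apply: measurable_EFin; apply: measurable_funD;
    by apply/measurable_EFinP/measurable_normX.
  - move=> w _; rewrite lee_fin normrM exprMn !exprD.
    move: (`|_| ^+ n) (`|_| ^+ n) => a b.
    by have := sqr_ge0 (a - b); nra.
under eq_integral do rewrite EFinD.
rewrite ge0_integralD//=; last 2 first.
- exact: measurable_normX.
- exact: measurable_normX.
by rewrite EFinD; exact: leeD.
Qed.

Lemma bounded_momentsX {I} (F : I -> T -> R) n :
  bounded_moments F -> bounded_moments (fun i w => F i w ^+ n).
Proof.
move=> bF; elim: n => [|n IH].
  by apply: (bounded_moments_cst _ 1) => _; rewrite normr1.
have := bounded_momentsM _ _ bF IH; congr bounded_moments.
by apply/funext => i; apply/funext => w; rewrite exprS.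
Qed.

(** The one-member case, so that the closure lemmas apply verbatim. *)
Definition has_moments (f : T -> R) := bounded_moments (fun _ : unit => f).

Lemma has_moments_of {I} {F : I -> T -> R} i : bounded_moments F -> has_moments (F i).
Proof. exact: (bounded_moments_reindex (fun=> i)). Qed.

Lemma has_moments_cst (c : R) : has_moments (fun=> c).
Proof. by apply: (bounded_moments_cst _ `|c|). Qed.

Lemma has_moments_integrable (f : T -> R) :
  has_moments f -> P.-integrable setT (EFin \o f).
Proof.
move=> [mf bf]; apply/integrableP; split; first exact/measurable_EFinP/(mf tt).
have [C /(_ tt) HC] := bf 1%N; apply: le_lt_trans (ltry C).
by apply: le_trans HC; under [leRHS]eq_integral do rewrite expr1.
Qed.

Lemma has_moments_measurable {f : T -> R} : has_moments f -> measurable_fun setT f.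
Proof. by case=> /(_ tt). Qed.

End BoundedMoments.

(** * Linearity of expectation, and limits under bounded moments *)
Section MomentCalculus.
Context {R : realType} {d : measure_display} {T : measurableType d}
  (P : probability T R).
Implicit Types f g : T -> R.

Lemma has_momentsD f g : has_moments P f -> has_moments P g ->
  has_moments P (fun w => f w + g w).
Proof. exact: bounded_momentsD. Qed.

Lemma has_momentsN f : has_moments P f -> has_moments P (fun w => - f w).
Proof. exact: bounded_momentsN. Qed.

Lemma has_momentsM f g : has_moments P f -> has_moments P g ->
  has_moments P (fun w => f w * g w).
Proof. exact: bounded_momentsM. Qed.

Lemma has_momentsX f n : has_moments P f -> has_moments P (fun w => f w ^+ n).
Proof. exact: bounded_momentsX. Qed.

Lemma has_moments_indic (A : set T) : measurable A -> has_moments P (\1_A).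
Proof.
move=> mA; apply: (bounded_moments_bounded P _ 1) => [_|_ w].
  exact: measurable_indic.
by rewrite indicE; case: (_ \in _); rewrite ?normr1 ?normr0.
Qed.

Lemma has_moments_ext f g : (forall w, f w = g w) ->
  has_moments P f -> has_moments P g.
Proof. by move=> /funext ->. Qed.

Lemma has_moments_le f g : has_moments P f -> measurable_fun setT g ->
  (forall w, `|g w| <= `|f w|) -> has_moments P g.
Proof.
by move=> bf mg gf; apply: (bounded_moments_le P id _ _ bf) => // _ w.
Qed.

Lemma has_moments_norm f : has_moments P f -> has_moments P (fun w => `|f w|).
Proof.
move=> mf; apply: (has_moments_le _ _ mf) => [|w]; last by rewrite normr_id.
exact/measurableT_comp/(has_moments_measurable P)/mf.
Qed.

Lemma has_moments_sum n (F : nat -> T -> R) :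
  (forall k, (k < n)%N -> has_moments P (F k)) ->
  has_moments P (fun w => \sum_(k < n) F k w).
Proof.
elim: n => [|n IH] HF.
  apply: (has_moments_ext (fun=> 0)); last exact: has_moments_cst.
  by move=> w; rewrite big_ord0.
apply: (has_moments_ext (fun w => (\sum_(k < n) F k w) + F n w)).
  by move=> w; rewrite big_ord_recr.
apply: has_momentsD; last exact: HF.
by apply: IH => k kn; apply: HF; rewrite ltnS ltnW.
Qed.

Lemma expectD f g : has_moments P f -> has_moments P g ->
  \int[P]_w (f w + g w) = \int[P]_w f w + \int[P]_w g w.
Proof. by move=> mf mg; apply: RintegralD => //; exact: has_moments_integrable. Qed.

Lemma expectB f g : has_moments P f -> has_moments P g ->
  \int[P]_w (f w - g w) = \int[P]_w f w - \int[P]_w g w.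
Proof. by move=> mf mg; apply: RintegralB => //; exact: has_moments_integrable. Qed.

Lemma expectZ (c : R) f : has_moments P f ->
  \int[P]_w (c * f w) = c * \int[P]_w f w.
Proof. by move=> mf; apply: RintegralZl => //; exact: has_moments_integrable. Qed.

Lemma expect_cst (c : R) : \int[P]_w c = c.
Proof. by rewrite Rintegral_cst//= probability_setT/= mulr1. Qed.

Lemma expect_ext f g : (forall w, f w = g w) -> \int[P]_w f w = \int[P]_w g w.
Proof. by move=> /funext ->. Qed.

Lemma expect_le f g : has_moments P f -> has_moments P g ->
  (forall w, f w <= g w) -> \int[P]_w f w <= \int[P]_w g w.
Proof. by move=> mf mg fg; apply: le_Rintegral => //; exact: has_moments_integrable. Qed.

Lemma expect_ge0 f : (forall w, 0 <= f w) -> 0 <= \int[P]_w f w.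
Proof. by move=> f0; apply: Rintegral_ge0. Qed.

Lemma expect_sum n (F : nat -> T -> R) :
  (forall k, (k < n)%N -> has_moments P (F k)) ->
  \int[P]_w (\sum_(k < n) F k w) = \sum_(k < n) \int[P]_w F k w.
Proof.
elim: n => [|n IH] HF.
  by rewrite big_ord0; under eq_Rintegral do rewrite big_ord0; rewrite expect_cst.
rewrite big_ord_recr -IH/=; last by move=> k kn; apply: HF; rewrite ltnS ltnW.
rewrite -expectD; last 2 first.
- by apply: has_moments_sum => k kn; apply: HF; rewrite ltnS ltnW.
- exact: HF.
by apply: expect_ext => w; rewrite big_ord_recr.
Qed.

Lemma expectE f : has_moments P f ->
  (\int[P]_w (f w)%:E = (\int[P]_w f w)%:E)%E.
Proof.
move=> mf; rewrite /Rintegral fineK//.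
by apply: integrable_fin_num => //; exact: has_moments_integrable.
Qed.

End MomentCalculus.

Ltac moments :=
  match goal with
  | |- has_moments _ (fun=> _) => exact: has_moments_cst
  | |- has_moments _ (fun w => @?f w + @?g w) =>
      refine (has_momentsD _ f g _ _); moments
  | |- has_moments _ (fun w => - @?f w) => refine (has_momentsN _ f _); moments
  | |- has_moments _ (fun w => @?f w * @?g w) =>
      refine (has_momentsM _ f g _ _); moments
  | |- has_moments _ (fun w => @?f w ^+ ?n) => refine (has_momentsX _ f n _); moments
  | |- has_moments _ (fun w => ?f w) => change (has_moments _ f); moments
  | H : has_moments ?P ?f |- has_moments ?P ?f => exact H
  | H : forall _, has_moments _ _ |- _ => exact (H _)
  end.

Section MomentLimits.
Context {R : realType} {d : measure_display} {T : measurableType d}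
  (P : probability T R).

(** Fatou's lemma: pointwise limits inherit moment bounds. *)
Lemma bounded_moments_cvg {I} (F : nat -> I -> T -> R) (G : I -> T -> R) :
  bounded_moments P (fun p : nat * I => F p.1 p.2) ->
  (forall i w, F n i w @[n --> \oo] --> G i w) -> bounded_moments P G.
Proof.
move=> [mF bF] FG; have mG i : measurable_fun setT (G i).
  apply: (@measurable_fun_cvg _ _ _ _ (fun n => F n i)) => [n|w _]; last exact: FG.
  exact: (mF (n, i)).
split=> // n; have [C HC] := bF n; exists C => i.
have -> : (\int[P]_w (`|G i w| ^+ n)%:E =
    \int[P]_w limn_einf (fun k => (`|F k i w| ^+ n)%:E))%E.
  apply: eq_integral => w _.
  suff h : (`|F k i w| ^+ n)%:E @[k --> \oo] --> (`|G i w| ^+ n)%:E.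
    by rewrite is_cvg_limn_einfE ?(cvg_lim _ h)//; apply/cvg_ex; eexists; exact: h.
  apply: cvg_EFin; first exact: nearW.
  have : (`|F k i w| ^+ n) @[k --> \oo] --> `|G i w| ^+ n.
    apply: (@cvg_comp _ _ _ (fun k => F k i w) (fun x => `|x| ^+ n)); first exact: FG.
  apply: (@continuous_comp _ _ _ (fun x : R => `|x|) (fun x : R => x ^+ n)).
      exact: norm_continuous.
    exact: exprn_continuous.
  by [].
apply: le_trans (fatou P measurableT _ _) _.
- by move=> k; apply: measurable_normX; exact: (mF (k, i)).
- by move=> k w _; rewrite lee_fin exprn_ge0.
rewrite limn_einf_lim; apply: lime_le.
  exact: is_cvg_einfs.
apply: nearW => k; rewrite ?/einfs.
apply: le_trans (HC (k, i)); apply: ereal_inf_lbound; exists k => //=.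
Qed.

(** A case of Vitali's theorem.  The map x / (1 + e x^2) is bounded and moves
    x by at most e |x|^3, so bounded third moments make its composition with F n an
    approximation in mean, uniformly in n, and dominated convergence applies to
    these bounded compositions. *)
Lemma expect_cvg (F : nat -> T -> R) (f : T -> R) : bounded_moments P F ->
  (forall w, F n w @[n --> \oo] --> f w) ->
  \int[P]_w F n w @[n --> \oo] --> \int[P]_w f w.
Proof.
move=> bF Ff; have mF n : has_moments P (F n) by exact: has_moments_of n bF.
have mf : has_moments P f.
  apply: (bounded_moments_cvg (fun n (_ : unit) => F n)) => [|_ w]; last exact: Ff.
  exact: (bounded_moments_reindex P (fun p : nat * unit => p.1)).
have [C C0 HC] : exists2 C, 0 < C & forall n, \int[P]_w `|F n w| ^+ 3 <= C.
  have [C HC] := bF.2 3%N; exists (`|C| + 1) => [|n]; first by rewrite ltr_wpDl.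
  have m3 : has_moments P (fun w => `|F n w| ^+ 3).
    by apply: has_momentsX; exact: has_moments_norm.
  have := HC n; rewrite (expectE _ _ m3) lee_fin => /le_trans; apply.
  by have := ler_norm C; lra.
pose phi (e x : R) := x / (1 + e * x ^+ 2).
have phiB (e x : R) : 0 < e -> `|x - phi e x| <= e * `|x| ^+ 3.
  move=> e0; have D : 1 <= 1 + e * x ^+ 2 by rewrite lerDl mulr_ge0 ?sqr_ge0 ?ltW.
  have D0 : 1 + e * x ^+ 2 != 0 by rewrite gt_eqF// (lt_le_trans _ D).
  have -> : x - phi e x = (e * x ^+ 3) / (1 + e * x ^+ 2).
    by rewrite /phi; field.
  rewrite normrM normrM normrX normfV (gtr0_norm e0) (ger0_norm (le_trans _ D))//.
  rewrite ler_pdivrMr ?(lt_le_trans _ D)// ler_peMr//.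
  by rewrite mulr_ge0 ?exprn_ge0// ltW.
have phi_bnd (e x : R) : 0 < e -> `|phi e x| <= 1 + e^-1.
  move=> e0; have D : 1 <= 1 + e * x ^+ 2 by rewrite lerDl mulr_ge0 ?sqr_ge0 ?ltW.
  rewrite normrM normfV (ger0_norm (le_trans _ D))//.
  rewrite ler_pdivrMr ?(lt_le_trans _ D)//.
  have -> : (1 + e^-1) * (1 + e * x ^+ 2) = 1 + x ^+ 2 + (e * x ^+ 2 + e^-1).
    by field; rewrite gt_eqF.
  have h1 : 0 <= e * x ^+ 2 by rewrite mulr_ge0 ?sqr_ge0 ?ltW.
  have h2 : 0 <= e^-1 by rewrite invr_ge0 ltW.
  have h3 : `|x| <= 1 + x ^+ 2.
    by rewrite -(real_normK (num_real x)); have := sqr_ge0 (`|x| - 1); nra.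
  by lra.
have phi_cont (e : R) : 0 < e -> continuous (phi e).
  move=> e0 x; apply: cvgM; first exact: cvg_id.
  apply: cvgV.
    by rewrite gt_eqF// (@lt_le_trans _ _ 1)// lerDl mulr_ge0 ?sqr_ge0 ?ltW.
  apply: cvgD; first exact: cvg_cst.
  by apply: cvgM; [exact: cvg_cst|exact: exprn_continuous].
have phi_mom (e : R) g : 0 < e -> has_moments P g -> has_moments P (fun w => phi e (g w)).
  move=> e0 mg; apply: (bounded_moments_bounded P _ (1 + e^-1)) => [_|_ w]; last exact: phi_bnd.
  apply: (measurableT_comp (continuous_measurable_fun (phi_cont e e0))).
  exact: has_moments_measurable mg.
have close (e D : R) g : 0 < e -> has_moments P g -> \int[P]_w `|g w| ^+ 3 <= D ->
    `|\int[P]_w g w - \int[P]_w phi e (g w)| <= e * D.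
  move=> e0 mg gD; have mpg := phi_mom e g e0 mg.
  rewrite -expectB//; apply: le_trans (le_normr_Rintegral measurableT _) _.
    by apply: (has_moments_integrable P); apply: has_momentsD => //; exact: has_momentsN.
  apply: le_trans (_ : \int[P]_w (e * `|g w| ^+ 3) <= _); last first.
    rewrite expectZ; first by rewrite ler_pM2l.
    by apply: has_momentsX; exact: has_moments_norm.
  apply: expect_le => [||w]; last exact: phiB.
    by apply: has_moments_norm; apply: has_momentsD => //; exact: has_momentsN.
  apply: has_momentsM; first exact: has_moments_cst.
  by apply: has_momentsX; exact: has_moments_norm.
have phi_cvg (e : R) : 0 < e ->
    \int[P]_w phi e (F n w) @[n --> \oo] --> \int[P]_w phi e (f w).
  move=> e0; apply: fine_cvg; rewrite -(expectE P _ (phi_mom e f e0 mf)).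
  have [//|//||||_ _] := @dominated_convergence _ T R P setT measurableT
    (fun n w => (phi e (F n w))%:E) (fun w => (phi e (f w))%:E) (fun=> (1 + e^-1)%:E).
  - by move=> n; apply: measurable_EFin; exact/(has_moments_measurable P)/phi_mom.
  - by apply: measurable_EFin; exact/(has_moments_measurable P)/phi_mom.
  - apply: aeW => w _; apply: cvg_EFin; first exact: nearW.
    apply: (@cvg_comp _ _ _ (fun k => F k w) (phi e)); first exact: Ff.
    exact: phi_cont.
  - exact: (has_moments_integrable P _ (has_moments_cst P (1 + e^-1))).
  - by apply: aeW => w n _; rewrite lee_fin phi_bnd.
  by [].
pose D := \int[P]_w `|f w| ^+ 3.
have D0 : 0 <= D by apply: expect_ge0 => w; exact: exprn_ge0.
apply/cvgrPdist_lt => eta eta0.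
pose e := eta / (3 * (C + D)).
have CD : 0 < C + D by rewrite ltr_pwDl.
have e0 : 0 < e by rewrite divr_gt0// mulr_gt0.
have /cvgrPdist_lt/(_ (eta / 3)) := phi_cvg e e0.
rewrite divr_gt0// => /(_ isT); apply: filterS => n.
have := close e C (F n) e0 (mF n) (HC n).
have := close e D f e0 mf (lexx _).
have -> : e * C = eta / 3 - e * D by rewrite /e; field; rewrite gt_eqF.
rewrite !ler_norml !ltr_norml => /andP[? ?] /andP[? ?] /andP[? ?].
by apply/andP; split; lra.
Qed.

End MomentLimits.

(** * Taylor expansion of the exponential *)
Section Exponential.
Context {R : realType}.

Definition exp_taylor (n : nat) (x : R) : R := \sum_(i < n) x ^+ i / i`!%:R.

Lemma is_derive_exp_taylor n (x : R) :
  is_derive x 1 (exp_taylor n.+1) (exp_taylor n x).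
Proof.
elim: n => [|n IH].
  have -> : exp_taylor 1 = cst 1.
    by apply/funext => y; rewrite /exp_taylor big_ord1 expr0 fact0 divr1.
  by rewrite /exp_taylor big_ord0; exact: is_derive_cst.
have -> : exp_taylor n.+2 =
    exp_taylor n.+1 + ((n.+1)`!%:R^-1 : R) *: (id ^+ n.+1 : R -> R).
  apply/funext => y; rewrite /exp_taylor big_ord_recr/=; congr (_ + _).
  rewrite mulrC /GRing.scale/=; congr (_ * _).
  by elim: (n.+1) => [//|k]; rewrite !exprS => ->.
have hX : is_derive x 1 (id ^+ n.+1 : R -> R) ((n.+1%:R * x ^+ n) *: 1).
  exact: is_deriveX.
apply: (is_derive_eq (is_deriveD IH (is_deriveZ _ hX))).
rewrite [RHS]/exp_taylor big_ord_recr/= -/(exp_taylor n x); congr (_ + _).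
rewrite /GRing.scale/= factS natrM.
have ? : (n`!%:R : R) != 0 by rewrite pnatr_eq0 -lt0n fact_gt0.
have ? : (n.+1%:R : R) != 0 by rewrite pnatr_eq0.
by field; apply/andP.
Qed.

(** Induction on n: the derivative of the remainder of order n.+1 is the
    remainder of order n, so the mean value theorem gives one more factor. *)
Lemma expR_taylor n (x : R) :
  `|expR x - exp_taylor n x| <= `|x| ^+ n * expR `|x|.
Proof.
elim: n x => [|n IH] x.
  rewrite /exp_taylor big_ord0 subr0 expr0 mul1r ger0_norm ?expR_ge0//.
  by rewrite ler_expR ler_norm.
pose f (y : R) := expR y - exp_taylor n.+1 y.
pose df (y : R) := expR y - exp_taylor n y.
have fdf (y : R) : is_derive y 1 f (df y).
  exact: (is_deriveB (is_derive_expR y) (is_derive_exp_taylor n y)).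
have f0 : f 0 = 0.
  rewrite /f expR0 /exp_taylor big_ord_recl big1 ?expr0 ?fact0 ?divr1 ?addr0 ?subrr//.
  by move=> i _; rewrite expr0n/= mul0r.
have fc a b : {within `[a, b], continuous f}.
  apply: derivable_within_continuous => y _.
  by have [] := fdf y.
have [c cx fx] : exists2 c, `|c| <= `|x| & f x = df c * x.
  case: (leP 0 x) => x0.
    have [c] := MVT_segment x0 (fun y _ => fdf y) (fc _ _).
    rewrite in_itv/= f0 !subr0 => /andP[c0 cx] ->; exists c => //.
    by rewrite !ger0_norm// (le_trans c0).
  have [c] := MVT_segment (ltW x0) (fun y _ => fdf y) (fc _ _).
  rewrite in_itv/= f0 !sub0r mulrN => /andP[c0 cx] /oppr_inj ->; exists c => //.
  by rewrite !ler0_norm ?lerN2// (ltW x0).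
rewrite -/(f x) fx normrM mulrC exprS -mulrA ler_wpM2l//.
apply: le_trans (IH c) _; apply: ler_pM => //.
- by rewrite lerXn2r ?nnegrE.
- by rewrite ler_expR.
Qed.

(** A polynomial of degree less than n that is O(x^n) at 0 is zero; this is how
    moments are read off from a moment generating function. *)
Lemma coef_eq0_of_small n (c : nat -> R) (C : R) :
  (forall x, 0 < x -> x <= 1 -> `|\sum_(i < n) c i * x ^+ i| <= C * x ^+ n) ->
  forall i, (i < n)%N -> c i = 0.
Proof.
elim: n c => [//|n IH] c Hc.
pose S := \sum_(i < n) `|c i.+1|.
have S0 : 0 <= S by apply: sumr_ge0.
have small x : 0 < x -> x <= 1 -> `|\sum_(i < n) c i.+1 * x ^+ i| <= S.
  move=> x0 x1; apply: le_trans (ler_norm_sum _ _ _) _.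
  apply: ler_sum => i _; rewrite normrM ler_piMr//.
  by rewrite normrX exprn_ile1// gtr0_norm.
have E x : \sum_(i < n.+1) c i * x ^+ i = c 0%N + x * \sum_(i < n) c i.+1 * x ^+ i.
  rewrite big_ord_recl expr0 mulr1 mulr_sumr; congr (_ + _).
  by apply: eq_bigr => i _; rewrite exprS mulrCA.
have c0 : c 0%N = 0.
  apply/eqP/negPn/negP => c0; have a0 : 0 < `|c 0%N| by rewrite normr_gt0.
  have D0 : 0 < `|c 0%N| + `|C| + S + 1 by have := normr_ge0 C; lra.
  pose x := `|c 0%N| / (`|c 0%N| + `|C| + S + 1).
  have x0 : 0 < x by rewrite divr_gt0.
  have nC := normr_ge0 C.
  have x1 : x <= 1 by rewrite ler_pdivrMr// mul1r; lra.
  have := Hc x x0 x1; rewrite E => h1.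
  have h2 : `|x * \sum_(i < n) c i.+1 * x ^+ i| <= x * S.
    by rewrite normrM gtr0_norm// ler_pM2l// small.
  have h3 : C * x ^+ n.+1 <= x * `|C|.
    rewrite exprS mulrCA ler_pM2l// (le_trans (ler_norm _))// normrM ler_piMr//.
    by rewrite normrX exprn_ile1// gtr0_norm.
  have h4 : `|c 0%N| = x * (`|c 0%N| + `|C| + S + 1) by rewrite /x divfK ?gt_eqF.
  have := ler_normB (c 0%N + x * \sum_(i < n) c i.+1 * x ^+ i)
                    (x * \sum_(i < n) c i.+1 * x ^+ i).
  rewrite addrK; nra.
case=> [//|i]; rewrite ltnS; apply: (IH (fun i => c i.+1)) => x x0 x1.
have := Hc x x0 x1; rewrite E c0 add0r normrM (gtr0_norm x0) exprS mulrCA.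
by rewrite ler_pM2l.
Qed.

End Exponential.

(** * Moments of the centred normal law *)
Section GaussianMoments.
Context {R : realType}.
Local Notation mu := (@lebesgue_measure R).

(** The density that defines the law is a version of its Radon-Nikodym
    derivative, for which the change of variables is known. *)
Lemma integral_normal_prob (s : R) (f : R -> \bar R) :
  measurable_fun setT f -> (forall x, (0 <= f x)%E) ->
  (\int[normal_prob 0 s]_x f x = \int[mu]_x (f x * (normal_pdf 0 s x)%:E))%E.
Proof.
move=> mf f0; have dom := @normal_prob_dominates R 0 s.
rewrite -(Radon_Nikodym_SigmaFinite.change_of_variables dom)//.
have mpdf : measurable_fun setT (fun x => (normal_pdf 0 s x)%:E).
  by apply: measurable_EFin; exact: measurable_normal_pdf.
have iRN := Radon_Nikodym_SigmaFinite.f_integrable dom.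
apply: ae_eq_integral => //.
- by apply: emeasurable_funM => //; exact: (measurable_int _ iRN).
- exact: emeasurable_funM.
apply: ae_eqe_mul2l; apply: integral_ae_eq => // E _ mE.
by rewrite -Radon_Nikodym_SigmaFinite.f_integral.
Qed.

(** Completing the square turns exp(a x) times the centred density into a
    constant times the density with mean a s^2, whose integral is 1. *)
Lemma normal_mgf (s a : R) : s != 0 ->
  (\int[normal_prob 0 s]_x (expR (a * x))%:E = (expR (a ^+ 2 * s ^+ 2 / 2))%:E)%E.
Proof.
move=> s0; rewrite integral_normal_prob; last 2 first.
- by apply: measurable_EFin; apply: measurableT_comp => //; exact: measurable_funM.
- by move=> x; rewrite lee_fin expR_ge0.
transitivity (\int[mu]_x ((expR (a ^+ 2 * s ^+ 2 / 2))%:E *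
    (normal_pdf (a * s ^+ 2) s x)%:E))%E.
  apply: eq_integral => x _; rewrite -!EFinM !normal_pdfE//; congr EFin.
  rewrite mulrCA [RHS]mulrCA; congr (_ * _).
  rewrite /normal_fun -!expRD; congr expR.
  by field.
rewrite ge0_integralZl//; last 2 first.
- by apply: measurable_EFin; exact: measurable_normal_pdf.
- by move=> x _; rewrite lee_fin normal_pdf_ge0.
by rewrite integral_normal_pdf mule1.
Qed.

Context {d : measure_display} {T : measurableType d} (P : probability T R).

Definition is_gaussian (s : R) (xi : T -> R) :=
  measurable_fun setT xi /\
  forall A, measurable A -> P (xi @^-1` A) = normal_prob 0 s A.

Section OneVariable.
Context (s : R) (xi : T -> R).
Hypotheses (s0 : s != 0) (gxi : is_gaussian s xi).

Let mxi : measurable_fun setT xi. Proof. by case: gxi. Qed.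

Let X : {RV P >-> measurableTypeR R} :=
  MeasurableFun.Pack (MeasurableFun.Class
    (isMeasurableFun.Build _ _ T (measurableTypeR R) xi mxi)).

Let mgf a : (\int[P]_w (expR (a * xi w))%:E = (expR (a ^+ 2 * s ^+ 2 / 2))%:E)%E.
Proof.
rewrite -normal_mgf//; transitivity (\int[distribution P X]_x (expR (a * x))%:E)%E.
  rewrite ge0_integral_distribution//.
  by apply: measurable_EFin; apply: measurableT_comp => //; exact: measurable_funM.
have h A : measurable A -> A `<=` [set: R] -> distribution P X A = normal_prob 0 s A.
  by move=> mA _; exact: gxi.2.
have := @eq_measure_integral _ _ _ _ (normal_prob 0 s) (distribution P X) (fun x => (expR (a * x))%:E) h.
exact.
Qed.

Let exp_moments a : has_moments P (fun w => expR (a * xi w)).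
Proof.
split=> [_|n].
  by apply: measurableT_comp => //; exact: measurable_funM.
exists (expR ((n%:R * a) ^+ 2 * s ^+ 2 / 2)) => _; rewrite -mgf.
rewrite le_eqVlt; apply/orP; left; apply/eqP; apply: eq_integral => w _; congr EFin.
by rewrite ger0_norm ?expR_ge0// -mulrA expRM_natl.
Qed.

(** |x| is at most exp x + exp (-x), and exponentials have moments since powers
    of exponentials are exponentials. *)
Lemma gaussian_has_moments : has_moments P xi.
Proof.
apply: (has_moments_le P (fun w => expR (1 * xi w) + expR (-1 * xi w))) => //.
  by apply: has_momentsD.
move=> w; rewrite mul1r mulN1r [leRHS]ger0_norm ?addr_ge0 ?expR_ge0//.
have h1 := expR_ge1Dx (xi w); have h2 := expR_ge1Dx (- xi w).
have h3 := expR_ge0 (xi w); have h4 := expR_ge0 (- xi w).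
by rewrite ler_norml; apply/andP; split; lra.
Qed.

Let mom := gaussian_has_moments.

Let expabs_moments : has_moments P (fun w => expR `|xi w|).
Proof.
apply: (has_moments_le P (fun w => expR (1 * xi w) + expR (-1 * xi w))) => //.
- by apply: has_momentsD.
- by apply: measurableT_comp => //; exact: measurableT_comp.
move=> w; rewrite mul1r mulN1r (ger0_norm (expR_ge0 _)).
rewrite [leRHS]ger0_norm ?addr_ge0 ?expR_ge0//.
by case: (ger0P (xi w)) => _; rewrite ?lerDl ?lerDr expR_ge0.
Qed.

(** Both E exp(a xi) and exp(a^2 s^2 / 2) have Taylor expansions at a = 0 up to
    an error O(a^5); comparing the coefficients below order 5 gives the moments. *)
Lemma gaussian_moments : [/\ \int[P]_w xi w = 0, \int[P]_w xi w ^+ 2 = s ^+ 2,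
  \int[P]_w xi w ^+ 3 = 0 & \int[P]_w xi w ^+ 4 = 3 * s ^+ 4].
Proof.
(* g lists the coefficients of exp(a^2 s^2 / 2) in powers of a. *)
pose g (i : nat) : R := nth 0 [:: 1; 0; s ^+ 2 / 2; 0; s ^+ 4 / 8] i.
pose c (i : nat) : R := \int[P]_w xi w ^+ i / i`!%:R - g i.
have mabs : has_moments P (fun w => `|xi w|) by exact: has_moments_norm.
pose D := \int[P]_w (`|xi w| ^+ 5 * expR `|xi w|).
pose B := (s ^+ 2 / 2) ^+ 3 * expR (s ^+ 2 / 2).
have c0 : forall i, (i < 5)%N -> c i = 0.
  apply: (coef_eq0_of_small _ _ (D + B)) => a a0 a1.
  have mT : has_moments P (fun w => exp_taylor 5 (a * xi w)).
    apply: (has_moments_sum P 5 (fun i w => (a * xi w) ^+ i / i`!%:R)) => k _.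
    apply: has_momentsM; last exact: has_moments_cst.
    apply: has_momentsX; apply: has_momentsM => //; exact: has_moments_cst.
  have h1 : `|\int[P]_w expR (a * xi w) - \int[P]_w exp_taylor 5 (a * xi w)|
      <= D * a ^+ 5.
    have mB : has_moments P (fun w => expR (a * xi w) - exp_taylor 5 (a * xi w)).
      by apply: has_momentsD => //; exact: has_momentsN.
    rewrite -expectB//; apply: le_trans (le_normr_Rintegral measurableT _) _.
      exact: (has_moments_integrable P).
    rewrite mulrC -expectZ; last by apply: has_momentsM => //; exact: has_momentsX.
    apply: expect_le => [||w].
    - exact: (has_moments_norm P _ mB).
    - apply: has_momentsM; first exact: has_moments_cst.
      by apply: has_momentsM => //; exact: has_momentsX.
    apply: le_trans (expR_taylor _ _) _.
    rewrite normrM (gtr0_norm a0) exprMn -mulrA ler_pM2l ?exprn_gt0//.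
    by rewrite ler_wpM2l ?exprn_ge0// ler_expR ler_piMl.
  have h2 : \int[P]_w expR (a * xi w) = expR (a ^+ 2 * s ^+ 2 / 2).
    by rewrite /Rintegral mgf.
  have h3 : \int[P]_w exp_taylor 5 (a * xi w) =
      \sum_(i < 5) (\int[P]_w xi w ^+ i / i`!%:R) * a ^+ i.
    rewrite (expect_sum P 5 (fun i w => (a * xi w) ^+ i / i`!%:R)) => [|k _]; last first.
      apply: has_momentsM; last exact: has_moments_cst.
      apply: has_momentsX; apply: has_momentsM => //; exact: has_moments_cst.
    apply: eq_bigr => i _.
    rewrite [RHS](_ : _ = a ^+ i / i`!%:R * \int[P]_w xi w ^+ i); last by ring.
    rewrite -expectZ; last exact: has_momentsX.
    by apply: expect_ext => w; rewrite exprMn mulrAC.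
  have h4 : `|expR (a ^+ 2 * s ^+ 2 / 2) - \sum_(i < 5) g i * a ^+ i| <= B * a ^+ 5.
    have -> : \sum_(i < 5) g i * a ^+ i = exp_taylor 3 (a ^+ 2 * s ^+ 2 / 2).
      rewrite /exp_taylor /g !big_ord_recr !big_ord0/=.
      by rewrite !factS fact0; field.
    apply: le_trans (expR_taylor _ _) _.
    have p0 : 0 <= a ^+ 2 * s ^+ 2 / 2 by rewrite divr_ge0// mulr_ge0 ?sqr_ge0.
    rewrite (ger0_norm p0).
    have -> : (a ^+ 2 * s ^+ 2 / 2) ^+ 3 * expR (a ^+ 2 * s ^+ 2 / 2) =
       ((s ^+ 2 / 2) ^+ 3 * expR (a ^+ 2 * s ^+ 2 / 2) * a ^+ 5) * a by field.
    have s20 : 0 <= s ^+ 2 / 2 by rewrite divr_ge0 ?sqr_ge0.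
    have a50 : 0 <= a ^+ 5 by rewrite exprn_ge0 ?ltW.
    rewrite -[leRHS]mulr1; apply: ler_pM; [ | exact: ltW | | exact: a1].
      by rewrite mulr_ge0// mulr_ge0 ?expR_ge0// exprn_ge0.
    rewrite ler_pM2r ?exprn_gt0//; apply: ler_wpM2l.
      by rewrite exprn_ge0 ?divr_ge0 ?sqr_ge0.
    rewrite ler_expR -mulrA ler_piMl ?divr_ge0 ?sqr_ge0//.
    by rewrite exprn_ile1// ltW.
  have -> : \sum_(i < 5) c i * a ^+ i =
     (expR (a ^+ 2 * s ^+ 2 / 2) - \sum_(i < 5) g i * a ^+ i) -
     (\int[P]_w expR (a * xi w) - \int[P]_w exp_taylor 5 (a * xi w)).
    rewrite h3 h2 [RHS](_ : _ = \sum_(i < 5) (\int[P]_w xi w ^+ i / i`!%:R) * a ^+ i -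
      \sum_(i < 5) g i * a ^+ i); last by ring.
    by rewrite -sumrB; apply: eq_bigr => i _; rewrite /c mulrBl.
  apply: le_trans (ler_normB _ _) _; rewrite mulrDl addrC.
  exact: lerD.
split.
- by have := c0 1%N isT; rewrite /c /g/= subr0 divr1.
- have := c0 2%N isT; rewrite /c /g/= (_ : 2`! = 2)%N// => h; lra.
- have := c0 3%N isT; rewrite /c /g/= (_ : 3`! = 6)%N// => h; lra.
- have := c0 4%N isT; rewrite /c /g/= (_ : 4`! = 24)%N// => h; lra.
Qed.

End OneVariable.
End GaussianMoments.

(** * Independence and products of expectations *)
Section Distribution.
Context {R : realType} {d d' : measure_display} {T : measurableType d}
  {U : measurableType d'} (P : probability T R).

Lemma integrable_distribution (X : {RV P >-> U}) (h : U -> \bar R) :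
  measurable_fun setT h -> P.-integrable setT (h \o X) ->
  (distribution P X).-integrable setT h.
Proof.
move=> mh /integrableP[_ ih]; apply/integrableP; split=> //.
by rewrite ge0_integral_distribution//; exact: measurableT_comp.
Qed.

End Distribution.

Section Independence.
Context {R : realType} {d : measure_display} {T : measurableType d}
  (P : probability T R).

Definition measurable_wrt (G : set (set T)) (g : T -> R) :=
  measurable_fun (setT : set (g_sigma_algebraType G)) g.

Context (G : set (set T)) (xi : T -> R).
Hypotheses (Gm : G `<=` measurable) (GI : setI_closed G) (GT : G setT)
  (mxi : measurable_fun setT xi)
  (indep : forall A B, G A -> measurable B ->
     P (A `&` xi @^-1` B) = (P A * P (xi @^-1` B))%E).

Let mpre B : measurable B -> measurable (xi @^-1` B).
Proof. by move=> mB; rewrite -[X in measurable X]setTI; exact: mxi. Qed.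

(** As functions of A both sides are finite measures, so it suffices that they
    agree on a generating family closed under intersection. *)
Lemma indep_sigma A B : <<s G >> A -> measurable B ->
  P (A `&` xi @^-1` B) = (P A * P (xi @^-1` B))%E.
Proof.
move=> sA mB; have mD := mpre B mB.
have r0 : 0 <= fine (P (xi @^-1` B)) by rewrite fine_ge0.
have fr : (NngNum r0)%:num%:E = P (xi @^-1` B) by rewrite /= fineK ?fin_num_measure.
transitivity (mscale (NngNum r0) P A); last by rewrite /mscale fr muleC.
apply: (@g_sigma_algebra_measure_unique _ R T G Gm (fun=> setT) (fun=> GT) _
  (mrestr P mD) (mscale (NngNum r0) P)) => //.
- by rewrite bigcup_const.
- move=> C GC; transitivity ((NngNum r0)%:num%:E * P C)%E; last by [].
  by rewrite fr muleC -indep.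
- by move=> _; rewrite -[ltLHS]/(P (setT `&` xi @^-1` B)) setTI ltey_eq fin_num_measure.
Qed.

Let sGm A : <<s G >> A -> measurable A.
Proof. by apply: smallest_sub => //; exact: sigma_algebra_measurable. Qed.

Let T' : measurableType _ := g_sigma_algebraType G.

(** By independence, the law of the pair (w, xi w) on the product of the space
    equipped with the sigma-algebra generated by G and the line is a product
    measure, so the formula is Fubini's theorem. *)
Lemma indep_expect (g : T -> R) (f : R -> R) : measurable_wrt G g ->
  measurable_fun setT f -> has_moments P g -> has_moments P (f \o xi) ->
  \int[P]_w (g w * f (xi w)) = \int[P]_w g w * \int[P]_w f (xi w).
Proof.
move=> mg mf hg hf.
have mid : measurable_fun setT (id : T -> T').
  by move=> _ B mB; rewrite setTI; exact: sGm.
pose X1 : {RV P >-> T'} := MeasurableFun.Pack (MeasurableFun.Class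
    (isMeasurableFun.Build _ _ T T' id mid)).
pose X2 : {RV P >-> R} := MeasurableFun.Pack (MeasurableFun.Class
    (isMeasurableFun.Build _ _ T _ xi mxi)).
have mphi : measurable_fun setT (fun w => (w, xi w) : T' * R).
  exact: measurable_fun_pair.
pose X : {RV P >-> (T' * R)%type} := MeasurableFun.Pack (MeasurableFun.Class
    (isMeasurableFun.Build _ _ T (T' * R)%type _ mphi)).
have prodE A : measurable A ->
   (distribution P X1 \x distribution P X2)%E A = distribution P X A.
  apply: product_measure_unique => A1 A2 mA1 mA2.
  by rewrite /distribution/= /pushforward/= -indep_sigma.
pose F (z : T' * R) := (g z.1 * f z.2)%:E.
have mF : measurable_fun setT F.
  apply: measurable_EFin; apply: measurable_funM.
    exact: measurableT_comp mg _.
  exact: measurableT_comp mf _.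
have hgf : has_moments P (fun w => g w * f (xi w)) by exact: has_momentsM.
have igf := has_moments_integrable P _ hgf.
have iF : (distribution P X1 \x distribution P X2)%E.-integrable setT F.
  apply/integrableP; split=> //.
  rewrite (eq_measure_integral (distribution P X)) => [|A mA _]; last exact: prodE.
  rewrite ge0_integral_distribution//; last exact: measurableT_comp.
  by case/integrableP: igf.
have iX2 : (distribution P X2).-integrable setT (EFin \o f).
  apply: integrable_distribution; first exact: measurable_EFin.
  exact: has_moments_integrable hf.
have fX2 : (\int[distribution P X2]_y (f y)%:E = (\int[P]_w f (xi w))%:E)%E.
  rewrite -(expectE P _ hf) integral_distribution//; first exact: measurable_EFin.
  exact: has_moments_integrable hf.
have E1 : (\int[P]_w (g w * f (xi w))%:E = \int[distribution P X]_z F z)%E.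
  by rewrite integral_distribution.
have E2 : (\int[distribution P X]_z F z =
    \int[(distribution P X1 \x distribution P X2)%E]_z F z)%E.
  by apply: eq_measure_integral => A mA _; exact/esym/prodE.
have E3 : (\int[(distribution P X1 \x distribution P X2)%E]_z F z =
    \int[distribution P X1]_x (g x * \int[P]_w f (xi w))%:E)%E.
  rewrite -(integral12_prod_meas1 iF); apply: eq_integral => x _.
  rewrite [LHS](_ : _ = \int[distribution P X2]_y ((g x)%:E * (f y)%:E))%E//.
  by rewrite integralZl// fX2.
have hgc : has_moments P (fun w => g w * \int[P]_w f (xi w)).
  by apply: has_momentsM => //; exact: has_moments_cst.
have E4 : (\int[distribution P X1]_x (g x * \int[P]_w f (xi w))%:E =
    \int[P]_w (g w * \int[P]_w f (xi w))%:E)%E.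
  rewrite integral_distribution//; last exact: (has_moments_integrable P _ hgc).
  by apply: measurable_EFin; apply: measurable_funM.
rewrite mulrC -expectZ// /Rintegral E1 E2 E3 E4.
by congr fine; apply: eq_integral => w _; rewrite mulrC.
Qed.

End Independence.

(** * Two independent sequences of independent variables *)
Section MeasurableWrt.
Context {R : realType} {d : measure_display} {T : measurableType d}.
Implicit Types (G : set (set T)) (f g : T -> R).

Lemma measurable_wrt_cst G (c : R) : measurable_wrt G (fun=> c).
Proof. exact: measurable_cst. Qed.

Lemma measurable_wrtD G f g : measurable_wrt G f -> measurable_wrt G g ->
  measurable_wrt G (fun w => f w + g w).
Proof. exact: measurable_funD. Qed.

Lemma measurable_wrtM G f g : measurable_wrt G f -> measurable_wrt G g ->
  measurable_wrt G (fun w => f w * g w).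
Proof. exact: measurable_funM. Qed.

Lemma measurable_wrtX G f n : measurable_wrt G f ->
  measurable_wrt G (fun w => f w ^+ n).
Proof. exact: measurable_funX. Qed.

Lemma measurable_wrtS G G' f : G `<=` G' -> measurable_wrt G f ->
  measurable_wrt G' f.
Proof. by move=> GG mf _ B mB; apply: (sub_smallest2r _ GG); [exact: smallest_sigma_algebra|exact: mf]. Qed.

End MeasurableWrt.

Section IndependentSequences.
Context {R : realType} {d : measure_display} {T : measurableType d}
  (P : probability T R) (xi eta : nat -> T -> R).

Definition box (z : nat -> T -> R) (n : nat) (B : nat -> set R) : set T :=
  [set w | forall i, (i < n)%N -> B i (z i w)].

(** A generating family, closed under intersection, of the sigma-algebra of
    xi 0 .. xi (a-1), eta 0 .. eta (b-1).  Separate indices a and b allow a step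
    of the planar walk to be split into two one-dimensional steps. *)
Definition past (a b : nat) : set (set T) :=
  [set A | exists B C : nat -> set R, [/\ forall i, measurable (B i),
    forall i, measurable (C i) & A = box xi a B `&` box eta b C]].

Definition independent_sequences := forall a b (B C : nat -> set R),
  (forall i, measurable (B i)) -> (forall i, measurable (C i)) ->
  P (box xi a B `&` box eta b C) =
  ((\prod_(i < a) P (xi i @^-1` B i)) * (\prod_(i < b) P (eta i @^-1` C i)))%E.

Hypotheses (mxi : forall i, measurable_fun setT (xi i))
  (meta : forall i, measurable_fun setT (eta i))
  (indep : independent_sequences).

Lemma boxS z n B : box z n.+1 B = box z n B `&` (z n @^-1` B n).
Proof.
apply/seteqP; split=> w /=.
  by move=> h; split=> [i /ltnW ?|]; exact: h.
move=> [h1 h2] i; rewrite ltnS leq_eqVlt => /predU1P[->//|]; exact: h1.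
Qed.

Lemma eq_box z n B B' : (forall i, (i < n)%N -> B i = B' i) ->
  box z n B = box z n B'.
Proof.
by move=> BB; apply/seteqP; split=> w h i ni; [rewrite -BB//|rewrite BB//]; exact: h.
Qed.

Lemma measurable_box z n B : (forall i, measurable_fun setT (z i)) ->
  (forall i, measurable (B i)) -> measurable (box z n B).
Proof.
move=> mz mB; elim: n => [|n IH].
  by rewrite (_ : box z 0 B = setT)//; apply/seteqP.
by rewrite boxS; apply: measurableI => //; rewrite -[X in measurable X]setTI; exact: mz.
Qed.

Lemma past_measurable a b : past a b `<=` measurable.
Proof.
by move=> _ [B [C [mB mC ->]]]; apply: measurableI; exact: measurable_box.
Qed.

Lemma past_setT a b : past a b setT.
Proof.
exists (fun=> setT), (fun=> setT); split=> //.
by apply/seteqP; split.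
Qed.

Lemma past_setI a b : setI_closed (past a b).
Proof.
move=> _ _ [B [C [mB mC ->]]] [B' [C' [mB' mC' ->]]].
exists (fun i => B i `&` B' i), (fun i => C i `&` C' i).
split=> [i|i|]; [exact: measurableI|exact: measurableI|].
apply/seteqP; split=> w /=.
  by move=> [[h1 h2] [h3 h4]]; split=> i ni; split; auto.
by move=> [h1 h2]; split; split=> i ni; [case: (h1 i ni)|case: (h2 i ni)|
  case: (h1 i ni)|case: (h2 i ni)].
Qed.

Lemma pastS a b a' b' : (a <= a')%N -> (b <= b')%N -> past a b `<=` past a' b'.
Proof.
move=> aa bb _ [B [C [mB mC ->]]].
exists (fun i => if (i < a)%N then B i else setT),
       (fun i => if (i < b)%N then C i else setT).
split=> [i|i|]; [by case: ifP|by case: ifP|].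
apply/seteqP; split=> w /= [h1 h2]; split=> i ni.
- by case: ifP => // /h1.
- by case: ifP => // /h2.
- by have := h1 i (leq_trans ni aa); rewrite ni.
- by have := h2 i (leq_trans ni bb); rewrite ni.
Qed.

Lemma past_xi a b i : (i < a)%N -> measurable_wrt (past a b) (xi i).
Proof.
move=> ia _ D mD; rewrite setTI; apply: sub_sigma_algebra.
exists (fun j => if j == i then D else setT), (fun=> setT).
split=> [j|//|]; first by case: ifP.
apply/seteqP; split=> w /=.
  by move=> Dw; split=> // j ja; case: eqP => [->|].
by move=> [/(_ i ia)]; rewrite eqxx.
Qed.

Lemma past_eta a b i : (i < b)%N -> measurable_wrt (past a b) (eta i).
Proof.
move=> ib _ D mD; rewrite setTI; apply: sub_sigma_algebra.
exists (fun=> setT), (fun j => if j == i then D else setT).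
split=> [//|j|]; first by case: ifP.
apply/seteqP; split=> w /=.
  by move=> Dw; split=> // j ja; case: eqP => [->|].
by move=> [_ /(_ i ib)]; rewrite eqxx.
Qed.

(* Adjoining one more constraint to a box yields a box, which is how the
   product rule implies the independence of the next variable from the past. *)
Let extend n (B : nat -> set R) D i := if (i < n)%N then B i else D.

Let extend_box z n B D : box z n.+1 (extend n B D) = box z n B `&` (z n @^-1` D).
Proof.
rewrite boxS {2}/extend ltnn; congr (_ `&` _); apply: eq_box => i ni.
by rewrite /extend ni.
Qed.

Let extend_prod (z : nat -> T -> R) n B D :
  (\prod_(i < n.+1) P (z i @^-1` extend n B D i) =
   (\prod_(i < n) P (z i @^-1` B i)) * P (z n @^-1` D))%E.
Proof.
rewrite big_ord_recr/= {2}/extend ltnn; congr (_ * _)%E.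
by apply: eq_bigr => i _; rewrite /extend ltn_ord.
Qed.

Lemma past_indep_xi a b A D : past a b A -> measurable D ->
  P (A `&` xi a @^-1` D) = (P A * P (xi a @^-1` D))%E.
Proof.
move=> [B [C [mB mC ->]]] mD; rewrite setIAC -extend_box !indep//; last first.
  by move=> i; rewrite /extend; case: ifP.
by rewrite extend_prod muleAC.
Qed.

Lemma past_indep_eta a b A D : past a b A -> measurable D ->
  P (A `&` eta b @^-1` D) = (P A * P (eta b @^-1` D))%E.
Proof.
move=> [B [C [mB mC ->]]] mD; rewrite -setIA -extend_box !indep//; last first.
  by move=> i; rewrite /extend; case: ifP.
by rewrite extend_prod muleA.
Qed.

End IndependentSequences.

Ltac wrt :=
  match goal with
  | |- measurable_wrt _ (fun=> _) => exact: measurable_wrt_cst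
  | |- measurable_wrt _ (fun w => @?f w + @?g w) =>
      refine (measurable_wrtD _ f g _ _); wrt
  | |- measurable_wrt _ (fun w => @?f w * @?g w) =>
      refine (measurable_wrtM _ f g _ _); wrt
  | |- measurable_wrt _ (fun w => @?f w ^+ ?n) =>
      refine (measurable_wrtX _ f n _); wrt
  | |- measurable_wrt _ (fun w => ?f w) => change (measurable_wrt _ f); wrt
  | H : measurable_wrt ?G ?f |- measurable_wrt ?G ?f => exact H
  | H : forall _, measurable_wrt _ _ |- _ => exact (H _)
  | H : forall a b k : nat, is_true (k <= _)%N -> _ |- _ => apply: H; lia
  end.

(** * Polynomials that are martingales along the Gaussian walk *)

(** The solution of the backward heat equation
      d/dt H + (1/2) (d^2/dx^2 + d^2/dy^2) H = 0
    equal at t = 0 to the even quartic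
      a_0 + a_1 x^2 + a_2 y^2 + a_3 x^4 + a_4 x^2 y^2 + a_5 y^4. *)
Definition heat_poly {R : realType} (a : nat -> R) (t x y : R) : R :=
  (a 0%N - t * (a 1%N + a 2%N) + t ^+ 2 * (3 * a 3%N + a 4%N + 3 * a 5%N)) +
  (a 1%N - t * (6 * a 3%N + a 4%N)) * x ^+ 2 +
  (a 2%N - t * (a 4%N + 6 * a 5%N)) * y ^+ 2 +
  a 3%N * x ^+ 4 + a 4%N * (x ^+ 2 * y ^+ 2) + a 5%N * y ^+ 4.

Section GaussianStep.
Context {R : realType} {d : measure_display} {T : measurableType d}
  (P : probability T R) (G : set (set T)) (z : T -> R) (h : R).
Hypotheses (Gm : G `<=` measurable) (GI : setI_closed G) (GT : G setT)
  (indep : forall A B, G A -> measurable B ->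
     P (A `&` z @^-1` B) = (P A * P (z @^-1` B))%E)
  (h0 : 0 < h) (gz : is_gaussian P (Num.sqrt h) z).

Let s0 : Num.sqrt h != 0. Proof. by rewrite gt_eqF// sqrtr_gt0. Qed.
Let mz : has_moments P z. Proof. exact: (gaussian_has_moments P _ _ s0). Qed.

Lemma step_expectX (g : T -> R) n : measurable_wrt G g -> has_moments P g ->
  \int[P]_w (g w * z w ^+ n) = \int[P]_w g w * \int[P]_w z w ^+ n.
Proof.
move=> wg mg; apply: (indep_expect P G z Gm GI GT gz.1 indep g (fun x => x ^+ n)) => //.
exact: has_momentsX.
Qed.

(** The moments of z up to order 4 are 0, h, 0 and 3 h^2. *)
Lemma step_quartic (g0 g1 g2 g3 g4 : T -> R) :
  measurable_wrt G g0 -> measurable_wrt G g1 -> measurable_wrt G g2 ->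
  measurable_wrt G g3 -> measurable_wrt G g4 ->
  has_moments P g0 -> has_moments P g1 -> has_moments P g2 ->
  has_moments P g3 -> has_moments P g4 ->
  \int[P]_w (g0 w + g1 w * z w + g2 w * z w ^+ 2 + g3 w * z w ^+ 3 + g4 w * z w ^+ 4) =
  \int[P]_w (g0 w + h * g2 w + 3 * h ^+ 2 * g4 w).
Proof.
move=> w0 w1 w2 w3 w4 m0 m1 m2 m3 m4.
have [e1 e2 e3 e4] := gaussian_moments P _ _ s0 gz.
have s2 : Num.sqrt h ^+ 2 = h by rewrite sqr_sqrtr// ltW.
have s4 : Num.sqrt h ^+ 4 = h ^+ 2 by rewrite -[4%N]/(2 * 2)%N exprM s2.
rewrite !expectD; try by moments.
rewrite !step_expectX//.
have -> : \int[P]_w (g1 w * z w) = \int[P]_w g1 w * \int[P]_w z w.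
  by rewrite -(step_expectX g1 1).
rewrite e1 e2 e3 e4 s2 s4 !expectZ//; ring.
Qed.

Lemma step_odd (g : T -> R) : measurable_wrt G g -> has_moments P g ->
  \int[P]_w (g w * z w) = 0.
Proof.
move=> wg mg; have := step_expectX g 1 wg mg.
have [e1 _ _ _] := gaussian_moments P _ _ s0 gz.
by rewrite /= e1 mulr0.
Qed.

End GaussianStep.

(** An even power lies above its tangent at c.  Since the tangent at c is
    n c^(n-1) a - (n-1) c^n, replacing a and c by their absolute values can only
    raise it, so nonnegative arguments suffice; there induction on n works. *)
Lemma even_power_convex {R : realType} (a c : R) (n : nat) : ~~ odd n ->
  c ^+ n + n%:R * c ^+ n.-1 * (a - c) <= a ^+ n.
Proof.
have pos (x y : R) k : 0 <= x -> 0 <= y ->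
    y ^+ k.+1 + k.+1%:R * y ^+ k * (x - y) <= x ^+ k.+1.
  move=> x0 y0; elim: k => [|k IH]; first by rewrite !expr1 expr0; lra.
  have := ler_wpM2l x0 IH; rewrite -exprS; apply: le_trans.
  rewrite -subr_ge0.
  have -> : x * (y ^+ k.+1 + k.+1%:R * y ^+ k * (x - y)) -
     (y ^+ k.+2 + k.+2%:R * y ^+ k.+1 * (x - y)) =
     k.+1%:R * y ^+ k * (x - y) ^+ 2.
    by rewrite !exprS -(natr1 k.+1); ring.
  by rewrite mulr_ge0 ?sqr_ge0// mulr_ge0 ?exprn_ge0.
case: n => [|n] en; first by rewrite !expr0 !mul0r addr0.
have := pos `|a| `|c| n (normr_ge0 a) (normr_ge0 c).
have ev (u : R) : `|u| ^+ n.+1 = u ^+ n.+1 by rewrite -normrX ger0_norm ?exprn_even_ge0.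
rewrite !ev; apply: le_trans => /=.
have E (u v : R) : u ^+ n.+1 + n.+1%:R * u ^+ n * (v - u) =
   n.+1%:R * (u ^+ n * v) - n%:R * u ^+ n.+1.
  by rewrite exprS -(natr1 n); ring.
have := E `|c| `|a|; rewrite ev => ->; rewrite E lerD2r ler_wpM2l//.
by rewrite -normrX -normrM ler_norm.
Qed.

Section Walk.
Context {R : realType} {d : measure_display} {T : measurableType d}
  (P : probability T R).

Definition walk (x : R) (z : nat -> T -> R) (k : nat) (w : T) : R :=
  x + \sum_(i < k) z i w.

Lemma walkS c z k w : walk c z k.+1 w = walk c z k w + z k w.
Proof. by rewrite /walk big_ord_recr addrA. Qed.

Lemma has_moments_walk c z k : (forall i, has_moments P (z i)) ->
  has_moments P (walk c z k).
Proof.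
move=> hz; apply: has_momentsD; first exact: has_moments_cst.
exact: has_moments_sum.
Qed.

Lemma walk_wrt (G : set (set T)) c z k :
  (forall i, (i < k)%N -> measurable_wrt G (z i)) -> measurable_wrt G (walk c z k).
Proof.
elim: k => [|k IH] wz.
  have -> : walk c z 0 = fun=> c by apply/funext => w; rewrite /walk big_ord0 addr0.
  exact: measurable_wrt_cst.
have -> : walk c z k.+1 = fun w => walk c z k w + z k w by apply/funext => w; rewrite walkS.
by apply: measurable_wrtD; [apply: IH => i ik; apply: wz; lia|exact: wz].
Qed.

End Walk.

Section GaussianWalk.
Context {R : realType} {d : measure_display} {T : measurableType d}
  (P : probability T R) (xi eta : nat -> T -> R) (x y h : R).
Hypotheses (h0 : 0 < h)
  (gxi : forall i, is_gaussian P (Num.sqrt h) (xi i))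
  (geta : forall i, is_gaussian P (Num.sqrt h) (eta i))
  (indep : independent_sequences P xi eta).

Local Notation X := (walk x xi).
Local Notation Y := (walk y eta).

Let s0 : Num.sqrt h != 0. Proof. by rewrite gt_eqF// sqrtr_gt0. Qed.
Let mxi i : measurable_fun setT (xi i). Proof. by case: (gxi i). Qed.
Let meta i : measurable_fun setT (eta i). Proof. by case: (geta i). Qed.
Let hxi i : has_moments P (xi i). Proof. exact: (gaussian_has_moments P _ _ s0). Qed.
Let heta i : has_moments P (eta i). Proof. exact: (gaussian_has_moments P _ _ s0). Qed.

Local Notation past := (past xi eta).

Let wX a b k : (k <= a)%N -> measurable_wrt (past a b) (X k).
Proof. by move=> ka; apply: walk_wrt => i ik; apply: past_xi; lia. Qed.
Let wY a b k : (k <= b)%N -> measurable_wrt (past a b) (Y k).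
Proof. by move=> ka; apply: walk_wrt => i ik; apply: past_eta; lia. Qed.
Let hX k : has_moments P (X k). Proof. exact: has_moments_walk. Qed.
Let hY k : has_moments P (Y k). Proof. exact: has_moments_walk. Qed.

Let stepX a b := step_quartic P (past a b) (xi a) h
  (past_measurable xi eta mxi meta a b) (past_setI xi eta a b) (past_setT xi eta a b)
  (fun A B => past_indep_xi P xi eta indep a b A B) h0 (gxi a).
Let stepY a b := step_quartic P (past a b) (eta b) h
  (past_measurable xi eta mxi meta a b) (past_setI xi eta a b) (past_setT xi eta a b)
  (fun A B => past_indep_eta P xi eta indep a b A B) h0 (geta b).

(** The moments of a Gaussian step match the heat flow on polynomials of degree
    4 exactly, so there is no error term.  The step is performed first in y,
    given the past and the step in x, and then in x; b0, b2, b4 and e0, e2, e4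
    are the coefficients of the even powers in the two expansions. *)
Lemma heat_poly_step (a : nat -> R) (t : R) (g : T -> R) k :
  measurable_wrt (past k k) g -> has_moments P g ->
  \int[P]_w (g w * heat_poly a (t + h) (X k.+1 w) (Y k.+1 w)) =
  \int[P]_w (g w * heat_poly a t (X k w) (Y k w)).
Proof.
move=> wg mg.
have wg' : measurable_wrt (past k.+1 k) g.
  by apply: measurable_wrtS wg; apply: pastS.
set c0 := a 0%N - (t + h) * (a 1%N + a 2%N) + (t + h) ^+ 2 * (3 * a 3%N + a 4%N + 3 * a 5%N).
set c1 := a 1%N - (t + h) * (6 * a 3%N + a 4%N).
set c2 := a 2%N - (t + h) * (a 4%N + 6 * a 5%N).
pose b2 w := g w * (c2 + a 4%N * X k.+1 w ^+ 2).
pose b4 w := g w * a 5%N.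
pose b0 w := g w * (c0 + c1 * X k.+1 w ^+ 2 + a 3%N * X k.+1 w ^+ 4).
transitivity (\int[P]_w ((b0 w + b2 w * Y k w ^+ 2 + b4 w * Y k w ^+ 4) +
    (2 * (b2 w * Y k w) + 4 * (b4 w * Y k w ^+ 3)) * eta k w +
    (b2 w + 6 * (b4 w * Y k w ^+ 2)) * eta k w ^+ 2 +
    (4 * (b4 w * Y k w)) * eta k w ^+ 3 + b4 w * eta k w ^+ 4)).
  apply: expect_ext => w; rewrite /heat_poly -/c0 -/c1 -/c2 (walkS y) /b0 /b2 /b4.
  by ring.
have wb2 : measurable_wrt (past k.+1 k) b2 by rewrite /b2; wrt.
have wb4 : measurable_wrt (past k.+1 k) b4 by rewrite /b4; wrt.
have wb0 : measurable_wrt (past k.+1 k) b0 by rewrite /b0; wrt.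
have mb2 : has_moments P b2 by rewrite /b2; moments.
have mb4 : has_moments P b4 by rewrite /b4; moments.
have mb0 : has_moments P b0 by rewrite /b0; moments.
rewrite (stepY k.+1 k); try by wrt. all: try by moments.
pose e2 w := g w * (c1 + a 4%N * (Y k w ^+ 2 + h)).
pose e4 w := g w * a 3%N.
pose e0 w := g w * (c0 + c2 * (Y k w ^+ 2 + h) +
   a 5%N * (Y k w ^+ 4 + 6 * h * Y k w ^+ 2 + 3 * h ^+ 2)).
transitivity (\int[P]_w ((e0 w + e2 w * X k w ^+ 2 + e4 w * X k w ^+ 4) +
    (2 * (e2 w * X k w) + 4 * (e4 w * X k w ^+ 3)) * xi k w +
    (e2 w + 6 * (e4 w * X k w ^+ 2)) * xi k w ^+ 2 +
    (4 * (e4 w * X k w)) * xi k w ^+ 3 + e4 w * xi k w ^+ 4)).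
  apply: expect_ext => w; rewrite /b0 /b2 /b4 /e0 /e2 /e4 (walkS x).
  by ring.
have we2 : measurable_wrt (past k k) e2 by rewrite /e2; wrt.
have we4 : measurable_wrt (past k k) e4 by rewrite /e4; wrt.
have we0 : measurable_wrt (past k k) e0 by rewrite /e0; wrt.
have me2 : has_moments P e2 by rewrite /e2; moments.
have me4 : has_moments P e4 by rewrite /e4; moments.
have me0 : has_moments P e0 by rewrite /e0; moments.
rewrite (stepX k k); try by wrt. all: try by moments.
apply: expect_ext => w; rewrite /e0 /e2 /e4 /heat_poly /c0 /c1 /c2.
by ring.
Qed.

Lemma walk_odd_step (g : T -> R) k : measurable_wrt (past k k) g -> has_moments P g ->
  \int[P]_w (g w * xi k w) = 0 /\ \int[P]_w (g w * eta k w) = 0.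
Proof.
move=> wg mg; split.
  apply: (step_odd P (past k k) (xi k) h) => //.
  - exact: past_measurable.
  - exact: past_setI.
  - exact: past_setT.
  - by move=> A B; exact: past_indep_xi.
apply: (step_odd P (past k k) (eta k) h) => //.
- exact: past_measurable.
- exact: past_setI.
- exact: past_setT.
- by move=> A B; exact: past_indep_eta.
Qed.

(** The tangent inequality for the convex function x^n, whose linear term is
    centred given the past: even powers of the walk are submartingales. *)
Lemma walk_even_step (g : T -> R) k n : ~~ odd n ->
  measurable_wrt (past k k) g -> has_moments P g -> (forall w, 0 <= g w) ->
  \int[P]_w (g w * X k w ^+ n) <= \int[P]_w (g w * X k.+1 w ^+ n) /\
  \int[P]_w (g w * Y k w ^+ n) <= \int[P]_w (g w * Y k.+1 w ^+ n).
Proof.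
move=> en wg mg g0.
have wgX : measurable_wrt (past k k) (fun w => g w * n%:R * X k w ^+ n.-1) by wrt.
have wgY : measurable_wrt (past k k) (fun w => g w * n%:R * Y k w ^+ n.-1) by wrt.
have [zX _] := walk_odd_step _ k wgX ltac:(moments).
have [_ zY] := walk_odd_step _ k wgY ltac:(moments).
split.
  rewrite -[leLHS]addr0 -zX -expectD; [|by moments|by moments].
  apply: expect_le; [by moments|by moments|] => w.
  have := ler_wpM2l (g0 w) (even_power_convex (X k.+1 w) (X k w) n en).
  apply: le_trans; rewrite walkS (addrC (X k w)) addrK le_eqVlt; apply/orP; left.
  by apply/eqP; ring.
rewrite -[leLHS]addr0 -zY -expectD; [|by moments|by moments].
apply: expect_le; [by moments|by moments|] => w.
have := ler_wpM2l (g0 w) (even_power_convex (Y k.+1 w) (Y k w) n en).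
apply: le_trans; rewrite walkS (addrC (Y k w)) addrK le_eqVlt; apply/orP; left.
by apply/eqP; ring.
Qed.

End GaussianWalk.

(** * Stopping the walk *)
Section StoppingIndex.
Context {R : realType} {d : measure_display} {T : measurableType d}
  (P : probability T R) (A : nat -> set T).
Hypotheses (mA : forall k, measurable (A k)) (decA : forall k, A k.+1 `<=` A k).

(** If A k is the event that the walk is still running at time k, this is the
    smaller of n and the first k outside A k.  Counting the indices makes the
    stopped walk a telescoping sum with the indicators of A k as weights. *)
Definition stop (n : nat) (w : T) : nat := (\sum_(k < n) (w \in A k))%N.

Let hA k : has_moments P (\1_(A k)). Proof. exact: has_moments_indic. Qed.

Lemma in_decA j k w : (j <= k)%N -> w \in A k -> w \in A j.
Proof.
move=> jk; rewrite !inE; elim: k jk => [|k IH]; first by rewrite leqn0 => /eqP ->.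
rewrite leq_eqVlt => /predU1P[-> //|]; rewrite ltnS => jk /decA; exact: IH.
Qed.

Lemma stop_in n w : w \in A n -> stop n w = n.
Proof.
move=> wA'; rewrite /stop (eq_bigr (fun=> 1%N)) ?sum1_card ?card_ord// => i _.
by rewrite (in_decA i n w (ltnW (ltn_ord i)) wA').
Qed.

Lemma stopS n w : stop n.+1 w = (stop n w + (w \in A n))%N.
Proof. by rewrite /stop big_ord_recr. Qed.

Lemma stop_step (f : nat -> R) n w :
  f (stop n.+1 w) = f (stop n w) + \1_(A n) w * (f n.+1 - f n).
Proof.
rewrite stopS indicE; case: (boolP (w \in A n)) => [wn|_].
  by rewrite stop_in// addn1 mul1r addrCA subrr addr0.
by rewrite addn0 mul0r addr0.
Qed.

Lemma stop_sum (f : nat -> R) n w :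
  f (stop n w) = f 0%N + \sum_(k < n) \1_(A k) w * (f k.+1 - f k).
Proof.
elim: n => [|n IH]; first by rewrite /stop !big_ord0 addr0.
by rewrite stop_step IH big_ord_recr/= addrA.
Qed.

Lemma has_moments_stop (F : nat -> T -> R) n : (forall k, has_moments P (F k)) ->
  has_moments P (fun w => F (stop n w) w).
Proof.
move=> hF; apply: (has_moments_ext P (fun w => F 0%N w +
  \sum_(k < n) \1_(A k) w * (F k.+1 w - F k w))) => [w|].
  by rewrite (stop_sum (fun k => F k w)).
apply: has_momentsD => //.
apply: (has_moments_sum P n (fun k w => \1_(A k) w * (F k.+1 w - F k w))) => k _.
by moments.
Qed.

Lemma expect_stop (F : nat -> T -> R) n : (forall k, has_moments P (F k)) ->
  \int[P]_w F (stop n w) w = \int[P]_w F 0%N w +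
  \sum_(k < n) (\int[P]_w (\1_(A k) w * F k.+1 w) - \int[P]_w (\1_(A k) w * F k w)).
Proof.
move=> hF; transitivity (\int[P]_w (F 0%N w +
  \sum_(k < n) \1_(A k) w * (F k.+1 w - F k w))).
  by apply: expect_ext => w; rewrite (stop_sum (fun k => F k w)).
have hI k : has_moments P (fun w => \1_(A k) w * (F k.+1 w - F k w)) by moments.
rewrite expectD//; last exact: (has_moments_sum P n (fun k w => \1_(A k) w * (F k.+1 w - F k w))).
congr (_ + _); rewrite (expect_sum P n (fun k w => \1_(A k) w * (F k.+1 w - F k w)))//.
apply: eq_bigr => k _; rewrite -expectB; [|by moments|by moments].
by apply: expect_ext => w; rewrite mulrBr.
Qed.

End StoppingIndex.

Section StoppedWalk.
Context {R : realType} {d : measure_display} {T : measurableType d}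
  (P : probability T R) (xi eta : nat -> T -> R) (x y h : R).
Hypotheses (h0 : 0 < h)
  (gxi : forall i, is_gaussian P (Num.sqrt h) (xi i))
  (geta : forall i, is_gaussian P (Num.sqrt h) (eta i))
  (indep : independent_sequences P xi eta).
Context (A : nat -> set T).
Hypotheses (sA : forall k, <<s past xi eta k k >> (A k))
  (decA : forall k, A k.+1 `<=` A k).

Local Notation X := (walk x xi).
Local Notation Y := (walk y eta).

Let s0 : Num.sqrt h != 0. Proof. by rewrite gt_eqF// sqrtr_gt0. Qed.
Let mxi i : measurable_fun setT (xi i). Proof. by case: (gxi i). Qed.
Let meta i : measurable_fun setT (eta i). Proof. by case: (geta i). Qed.
Let hX k : has_moments P (X k).
Proof. by apply: has_moments_walk => i; exact: (gaussian_has_moments P _ _ s0). Qed.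
Let hY k : has_moments P (Y k).
Proof. by apply: has_moments_walk => i; exact: (gaussian_has_moments P _ _ s0). Qed.

Let mA k : measurable (A k).
Proof.
have := sA k; apply: smallest_sub; first exact: sigma_algebra_measurable.
exact: past_measurable.
Qed.

Let hA k : has_moments P (\1_(A k)). Proof. exact: has_moments_indic. Qed.

Let wA k : measurable_wrt (past xi eta k k) (\1_(A k) : T -> R).
Proof.
by apply: (@measurable_indic _ (g_sigma_algebraType (past xi eta k k))); exact: sA.
Qed.

Lemma stopped_heat (a : nat -> R) n :
  \int[P]_w heat_poly a ((stop A n w)%:R * h) (X (stop A n w) w) (Y (stop A n w) w) =
  heat_poly a 0 x y.
Proof.
have hH k : has_moments P (fun w => heat_poly a (k%:R * h) (X k w) (Y k w)).
  by rewrite /heat_poly; moments.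
rewrite (expect_stop P A mA decA (fun k w => heat_poly a (k%:R * h) (X k w) (Y k w)))//.
rewrite big1 ?addr0 => [|k _].
  rewrite -(expect_cst P (heat_poly a 0 x y)); apply: expect_ext => w.
  by rewrite mul0r /walk !big_ord0 !addr0.
have -> : k.+1%:R * h = k%:R * h + h by rewrite -natr1; ring.
rewrite (heat_poly_step P xi eta x y h h0 gxi geta indep a _ (\1_(A k)) k)//.
by rewrite subrr.
Qed.

(** The walk at time n exceeds the stopped walk by the steps taken on the
    complements of the A k, which belong to the past as well, and by convexity
    these steps can only increase the expectation of an even power. *)
Lemma stopped_even_le n p : ~~ odd p ->
  \int[P]_w X (stop A n w) w ^+ p <= \int[P]_w X n w ^+ p /\
  \int[P]_w Y (stop A n w) w ^+ p <= \int[P]_w Y n w ^+ p.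
Proof.
move=> op.
have wB k : measurable_wrt (past xi eta k k) (fun w => 1 + -1 * \1_(A k) w : R).
  by wrt.
have mB k : has_moments P (fun w => 1 + -1 * \1_(A k) w) by moments.
have B0 k w : 0 <= 1 + -1 * \1_(A k) w :> R.
  by rewrite indicE; case: (_ \in _); rewrite ?mulr1 ?mulr0 ?addr0// addrN.
have H k := walk_even_step P xi eta x y h h0 gxi geta indep
  (fun w => 1 + -1 * \1_(A k) w) k p op (wB k) (mB k) (B0 k).
have key (F : nat -> T -> R) : (forall k, has_moments P (F k)) ->
    (forall k, \int[P]_w ((1 + -1 * \1_(A k) w) * F k w) <=
               \int[P]_w ((1 + -1 * \1_(A k) w) * F k.+1 w)) ->
    \int[P]_w F (stop A n w) w <= \int[P]_w F n w.
  move=> hF HF; rewrite (expect_stop P A mA decA F)//.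
  have -> : \int[P]_w F n w = \int[P]_w F 0%N w +
      \sum_(k < n) (\int[P]_w F k.+1 w - \int[P]_w F k w).
    by rewrite -(big_mkord xpredT (fun k => \int[P]_w F k.+1 w - \int[P]_w F k w))
      telescope_sumr// addrCA subrr addr0.
  rewrite lerD2l; apply: ler_sum => k _.
  have E j : \int[P]_w ((1 + -1 * \1_(A k) w) * F j w) =
      \int[P]_w F j w - \int[P]_w (\1_(A k) w * F j w).
    rewrite -expectB; [|by moments|by moments].
    by apply: expect_ext => w; ring.
  by have := HF k; rewrite !E; lra.
split; [apply: (key (fun k w => X k w ^+ p))|apply: (key (fun k w => Y k w ^+ p))].
- by move=> k; moments.
- by move=> k; have [] := H k.
- by move=> k; moments.
- by move=> k; have [] := H k.
Qed.

(** A step of the stopped walk after time n is taken on A k with k >= n, where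
    the walk stopped at n is the walk at n; this makes the cube measurable with
    respect to the past of the step. *)
Lemma stopped_orthogonal n m :
  \int[P]_w (Y (stop A n w) w ^+ 3 * (Y (stop A (n + m) w) w - Y (stop A n w) w)) = 0.
Proof.
have hS k := has_moments_stop P A mA decA Y k hY.
elim: m => [|m IH].
  rewrite addn0 -[RHS](expect_cst P); apply: expect_ext => w.
  by rewrite subrr mulr0.
pose k := (n + m)%N.
have hg : has_moments P (fun w => \1_(A k) w * Y n w ^+ 3) by moments.
have wg : measurable_wrt (past xi eta k k) (fun w => \1_(A k) w * Y n w ^+ 3).
  apply: measurable_wrtM => //; apply: measurable_wrtX; apply: walk_wrt => i ik.
  by apply: past_eta; rewrite /k; lia.
have [_ z] := walk_odd_step P xi eta h h0 gxi geta indep _ k wg hg.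
rewrite -[RHS]addr0 -{1}IH -z -expectD; [|by moments|]; last first.
  by apply: has_momentsM => //; exact: (gaussian_has_moments P _ _ s0).
apply: expect_ext => w; rewrite addnS (stop_step A decA (fun k => Y k w)) -/k.
rewrite walkS; case: (boolP (w \in A k)) => wk; rewrite indicE ?wk ?(negbTE wk).
  have -> : stop A n w = n by apply: stop_in => //; apply: (in_decA A decA _ _ _ _ wk); rewrite /k; lia.
  by ring.
by rewrite !mul0r !addr0.
Qed.

End StoppedWalk.

(** * Dyadic hitting times of a continuous path *)
Section FirstIndex.
Context {R : realType}.
Implicit Type g : nat -> R.

Definition first_index g (n : nat) : nat :=
  (\sum_(k < n) `[< forall i, (i <= k)%N -> (0 < g i)%R >])%N.

Lemma first_indexP g n : [/\ (first_index g n <= n)%N,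
  forall i, (i < first_index g n)%N -> 0 < g i &
  ((first_index g n < n)%N -> g (first_index g n) <= 0)].
Proof.
elim: n => [|n [le_n pos_n neg_n]].
  by rewrite /first_index big_ord0; split.
rewrite /first_index big_ord_recr/= -/(first_index g n).
case: asboolP => [an|nan].
  have cn : first_index g n = n.
    apply/eqP; rewrite eqn_leq le_n leqNgt; apply/negP => lt_n.
    by have := an _ le_n; rewrite ltNge neg_n.
  by rewrite cn addn1; split=> //; rewrite ltnn.
rewrite addn0; split=> [||_]; [exact: leqW|exact: pos_n|].
move: le_n; rewrite leq_eqVlt => /predU1P[cn|/neg_n//].
rewrite leNgt; apply/negP => g0; apply: nan => i.
rewrite leq_eqVlt => /predU1P[->|]; first by rewrite -cn.
by rewrite -{1}cn => /pos_n.
Qed.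

Lemma first_index_le g n i : g i <= 0 -> (first_index g n <= i)%N.
Proof.
by move=> gi; have [_ p _] := first_indexP g n; rewrite leqNgt; apply/negP => /p; rewrite ltNge gi.
Qed.

End FirstIndex.

Section DyadicHittingTime.
Context {R : realType}.
Implicit Type f : R -> R.

Definition dyadic_hits f : set R :=
  [set t | (exists N k : nat, t = k%:R / 2 ^+ N) /\ f t <= 0].

(** Dyadic times only, so that this is a limit of first visits on finite grids;
    the cap K keeps the set nonempty. *)
Definition hit f (K : nat) : R := inf (dyadic_hits f `|` [set K%:R]).

Definition grid_hit f (K N : nat) : R :=
  (first_index (fun i => f (i%:R / 2 ^+ N)) (K * 2 ^ N))%:R / 2 ^+ N.

Let two_gt0 N : 0 < 2 ^+ N :> R. Proof. exact: exprn_gt0. Qed.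

Let hits_lbound f K : lbound (dyadic_hits f `|` [set K%:R]) 0.
Proof. by move=> _ [[[N [k ->]] _]|->]; rewrite ?divr_ge0 ?exprn_ge0. Qed.

Let hits_inf f K : has_inf (dyadic_hits f `|` [set K%:R]).
Proof. by split; [exists K%:R; right|exists 0; exact: hits_lbound]. Qed.

Lemma hit_ge0 f K : 0 <= hit f K.
Proof. by apply: lb_le_inf; [exists K%:R; right|exact: hits_lbound]. Qed.

Lemma hit_le f K : hit f K <= K%:R.
Proof. by apply: ge_inf; [case: (hits_inf f K)|right]. Qed.

Lemma hit_le_dyadic f K t : dyadic_hits f t -> hit f K <= t.
Proof. by move=> ft; apply: ge_inf; [case: (hits_inf f K)|left]. Qed.

Lemma hit_mono f K L : (K <= L)%N -> hit f K <= hit f L.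
Proof.
move=> KL; apply: lb_le_inf; first by exists L%:R; right.
move=> t [ft|->]; first exact: hit_le_dyadic.
by apply: le_trans (hit_le f K) _; rewrite ler_nat.
Qed.

Lemma hit_le_grid f K N : hit f K <= grid_hit f K N.
Proof.
have [le_n _ neg_n] := first_indexP (fun i => f (i%:R / 2 ^+ N)) (K * 2 ^ N).
rewrite /grid_hit; move: le_n; rewrite leq_eqVlt => /predU1P[->|/neg_n fn].
  by rewrite natrM natrX mulfK ?gt_eqF//; exact: hit_le.
by apply: hit_le_dyadic; split=> //; exists N; eexists.
Qed.

Lemma grid_hit_ge0 f K N : 0 <= grid_hit f K N.
Proof. by rewrite /grid_hit divr_ge0 ?exprn_ge0. Qed.

Lemma grid_hit_le f K N : grid_hit f K N <= K%:R.
Proof.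
have [le_n _ _] := first_indexP (fun i => f (i%:R / 2 ^+ N)) (K * 2 ^ N).
by move: le_n; rewrite -(ler_nat R) natrM natrX /grid_hit ler_pdivrMr.
Qed.

(** A dyadic time belongs to all sufficiently fine grids, so the grid times
    eventually fall below any dyadic time at which f is nonpositive. *)
Lemma grid_hit_cvg f K : grid_hit f K N @[N --> \oo] --> hit f K.
Proof.
apply/cvgrPdist_le => e e0.
have [t ht th] := inf_adherent e0 (hits_inf f K); rewrite -/(hit f K) in th.
have [M HM] : exists M, forall N, (M <= N)%N -> grid_hit f K N <= t.
  case: ht => [[[M [k tE]] ft]|->]; last by exists 0%N => N _; exact: grid_hit_le.
  exists M => N MN.
  have tE' : t = (k * 2 ^ (N - M))%:R / 2 ^+ N.
    rewrite tE natrM natrX; have -> : 2 ^+ N = 2 ^+ M * 2 ^+ (N - M) :> R.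
      by rewrite -exprD subnKC.
    by field; rewrite !gt_eqF.
  rewrite tE' /grid_hit ler_pM2r ?invr_gt0// ler_nat; apply: first_index_le.
  by rewrite -tE'.
exists M => // N /= /HM h1; have h2 := hit_le_grid f K N.
by rewrite ler_norml; apply/andP; split; lra.
Qed.

Let cvg_inv2 : (2 ^+ N)^-1 @[N --> \oo] --> (0 : R).
Proof.
have : ((2^-1 : R) ^+ N) @[N --> \oo] --> (0 : R).
  by apply: cvg_expr; rewrite ger0_norm ?invr_ge0//; lra.
by under eq_fun do rewrite exprVn.
Qed.

Definition path_continuous f := forall (s : nat -> R) t,
  (forall n, 0 <= s n) -> s @ \oo --> t -> f (s n) @[n --> \oo] --> f t.

(** Continuity carries f < 0 from t to dyadic times just after t. *)
Lemma hit_dense f (t : R) K : 0 <= t -> path_continuous f -> f t < 0 -> hit f K <= t.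
Proof.
move=> t0 fc ft.
pose s N : R := (Num.truncn (t * 2 ^+ N)).+1%:R / 2 ^+ N.
have st N : t <= s N <= t + (2 ^+ N)^-1.
  have tN : 0 <= t * 2 ^+ N by rewrite mulr_ge0// exprn_ge0.
  have /andP[h1 h2] := truncn_itv tN.
  rewrite ler_pdivlMr// (ltW h2)/= ler_pdivrMr// mulrDl mulVf ?gt_eqF//.
  by rewrite -natr1 lerD2r.
have scvg : s @ \oo --> t.
  apply: (@squeeze_cvgr _ _ _ _ (fun=> t) (fun N => t + (2 ^+ N)^-1)).
  - by apply: nearW => N; exact: st.
  - exact: cvg_cst.
  - by rewrite -[X in _ --> X]addr0; apply: cvgD; [exact: cvg_cst|exact: cvg_inv2].
have s0 N : 0 <= s N by rewrite divr_ge0 ?exprn_ge0.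
have /cvgr_lt/(_ 0 ft) fs := fc s t s0 scvg.
apply: (cvgr_to_ge scvg).
near=> N; apply: hit_le_dyadic; split; first by exists N, (Num.truncn (t * 2 ^+ N)).+1.
by apply: ltW; near: N; exact: fs.
Unshelve. all: by end_near. Qed.

Lemma hit_le0 f K : path_continuous f -> hit f K < K%:R -> f (hit f K) <= 0.
Proof.
move=> fc hK.
have fs := fc (grid_hit f K) (hit f K) (grid_hit_ge0 f K) (grid_hit_cvg f K).
apply: (cvgr_to_le fs).
have /cvgr_lt/(_ _ hK) lt_K := grid_hit_cvg f K.
near=> N; have : grid_hit f K N < K%:R by near: N; exact: lt_K.
have [_ _ neg_n] := first_indexP (fun i => f (i%:R / 2 ^+ N)) (K * 2 ^ N).
rewrite ltr_pdivrMr// => lt_n; apply: neg_n.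
by rewrite -(ltr_nat R) natrM natrX.
Unshelve. all: by end_near. Qed.

(** One mesh before the grid time f is still positive, and these earlier times
    have the same limit. *)
Lemma hit_ge0_value f K : (0 < K)%N -> path_continuous f -> 0 < f 0 ->
  0 <= f (hit f K).
Proof.
move=> K0 fc f0; pose s N : R := grid_hit f K N - (2 ^+ N)^-1.
have idx N : (0 < first_index (fun i => f (i%:R / 2 ^+ N)) (K * 2 ^ N))%N.
  rewrite lt0n; apply/eqP => i0.
  have [_ _] := first_indexP (fun i => f (i%:R / 2 ^+ N)) (K * 2 ^ N).
  by rewrite i0 mul0r muln_gt0 K0 expn_gt0/= leNgt f0 => /(_ isT).
have sE N : s N = (first_index (fun i => f (i%:R / 2 ^+ N)) (K * 2 ^ N)).-1%:R / 2 ^+ N.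
  by rewrite /s /grid_hit -{1}(prednK (idx N)) -natr1; field; rewrite gt_eqF.
have scvg : s @ \oo --> hit f K.
  by rewrite -[X in _ --> X]subr0; apply: cvgB; [exact: grid_hit_cvg|exact: cvg_inv2].
have fs := fc s (hit f K) _ scvg.
apply: (cvgr_to_ge (fs _)) => [n|]; first by rewrite sE divr_ge0 ?exprn_ge0.
apply: nearW => N /=; rewrite sE.
have [_ pos _] := first_indexP (fun i => f (i%:R / 2 ^+ N)) (K * 2 ^ N).
by apply/ltW/(pos _); rewrite prednK.
Qed.

Lemma hit_eq0 f K : (0 < K)%N -> path_continuous f -> 0 < f 0 ->
  hit f K < K%:R -> f (hit f K) = 0.
Proof.
by move=> K0 fc f0 hK; apply/eqP; rewrite eq_le hit_le0 ?hit_ge0_value.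
Qed.

Lemma hit_le_level f g K : (forall t, f t <= g t) -> hit f K <= hit g K.
Proof.
move=> fg; apply: lb_le_inf; first by exists K%:R; right.
move=> t [[tD gt]|->]; last exact: hit_le.
by apply: hit_le_dyadic; split=> //; exact: le_trans gt.
Qed.

End DyadicHittingTime.

Section MeasurableHit.
Context {R : realType} {d : measure_display} {T : measurableType d}.

Lemma measurable_hit (f : T -> R -> R) K :
  (forall t, measurable_fun setT (fun w => f w t)) ->
  measurable_fun setT (fun w => hit (f w) K).
Proof.
move=> mf; apply: (@measurable_fun_cvg _ _ _ _ (fun N w => grid_hit (f w) K N));
  last by move=> w _; exact: grid_hit_cvg.
move=> N; apply: measurable_funM; last exact: measurable_cst.
pose alive k : set T := \bigcap_(i in [set i | (i <= k)%N]) [set w | 0 < f w (i%:R / 2 ^+ N)].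
have malive k : measurable (alive k).
  apply: bigcap_measurableType => i _.
  have := mf (i%:R / 2 ^+ N) measurableT _ (measurable_itv `]0, +oo[).
  rewrite setTI; congr measurable; apply/seteqP; split=> w /=; by rewrite in_itv/= andbT.
have -> : (fun w => (first_index (fun i => f w (i%:R / 2 ^+ N)) (K * 2 ^ N))%:R : R) =
    fun w => \sum_(k <- iota 0 (K * 2 ^ N)) \1_(alive k) w.
  apply/funext => w; rewrite /first_index natr_sum -(big_mkord xpredT (fun k =>
    (`[< forall i, (i <= k)%N -> 0 < f w (i%:R / 2 ^+ N) >])%:R)).
  by rewrite /index_iota subn0; apply: eq_bigr => k _; rewrite indicE; congr (_%:R).
by apply: measurable_sum => k; exact: measurable_indic.
Qed.

End MeasurableHit.

(** * Increments of a planar Brownian motion on a dyadic grid *)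
Section FamilyMoments.
Context {R : realType} {d : measure_display} {T : measurableType d}
  (P : probability T R).

Lemma bounded_moments_const {I} (c : R) : bounded_moments P (fun (_ : I) (_ : T) => c).
Proof. exact: (bounded_moments_cst P (fun=> c) `|c|). Qed.

Lemma bounded_moments_even {I} (F : I -> T -> R) :
  (forall i, has_moments P (F i)) ->
  (forall p, ~~ odd p -> exists C, forall i, \int[P]_w F i w ^+ p <= C) ->
  bounded_moments P F.
Proof.
move=> hF bF; split=> [i|n]; first exact: has_moments_measurable (hF i).
have [|C HC] := bF (n * 2)%N; first by rewrite oddM andbF.
exists (1 + C) => i.
have hn : has_moments P (fun w => `|F i w| ^+ n).
  by apply: has_momentsX; exact: has_moments_norm.
rewrite (expectE P _ hn) lee_fin.
have h2 : has_moments P (fun w => F i w ^+ (n * 2)) by apply: has_momentsX.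
apply: (@le_trans _ _ (\int[P]_w (1 + F i w ^+ (n * 2)))).
  apply: expect_le => //; first by apply: has_momentsD => //; exact: has_moments_cst.
  move=> w; have -> : F i w ^+ (n * 2) = (`|F i w| ^+ n) ^+ 2.
    by rewrite -normrX real_normK ?num_real// -exprM.
  by have := sqr_ge0 (`|F i w| ^+ n - 1); have := exprn_ge0 n (normr_ge0 (F i w)); nra.
rewrite expectD//; last exact: has_moments_cst.
by rewrite expect_cst lerD2l.
Qed.

End FamilyMoments.

Ltac family_moments :=
  match goal with
  | |- bounded_moments _ (fun _ _ => _) => exact: bounded_moments_const
  | |- bounded_moments _ (fun i w => @?f i w + @?g i w) =>
      refine (bounded_momentsD _ f g _ _); family_moments
  | |- bounded_moments _ (fun i w => - @?f i w) =>
      refine (bounded_momentsN _ f _); family_moments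
  | |- bounded_moments _ (fun i w => @?f i w * @?g i w) =>
      refine (bounded_momentsM _ f g _ _); family_moments
  | |- bounded_moments _ (fun i w => @?f i w ^+ ?n) =>
      refine (bounded_momentsX _ f n _); family_moments
  | _ => assumption
  end.

Section Increments.
Context {R : realType} {d : measure_display} {T : measurableType d}
  (P : probability T R).
Implicit Types (x : R) (z : R * R) (W : R -> {RV P >-> R}).

Definition increment (W : R -> {RV P >-> R}) (N i : nat) : T -> R :=
  W (i.+1%:R / 2 ^+ N) \- W (i%:R / 2 ^+ N).

(** The motion started exactly at x.  It agrees almost surely with W and is, at
    grid times, the walk of the increments at every point of the space. *)
Definition from_start (x : R) (W : R -> {RV P >-> R}) (t : R) (w : T) : R :=
  x + (W t w - W 0 w).

Lemma walk_increment x W N k w :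
  walk x (increment W N) k w = from_start x W (k%:R / 2 ^+ N) w.
Proof.
elim: k => [|k IH]; first by rewrite /walk /from_start big_ord0 mul0r subrr.
by rewrite walkS IH /from_start /increment/=; ring.
Qed.

Lemma increment_gaussian x W N i : brownian_motion x W ->
  is_gaussian P (Num.sqrt (2 ^+ N)^-1) (increment W N i).
Proof.
move=> bW; split; first exact: measurable_funB.
have lt : i%:R / 2 ^+ N < i.+1%:R / 2 ^+ N :> R.
  by rewrite ltr_pM2r ?invr_gt0 ?exprn_gt0// ltr_nat.
have ge0 : 0 <= i%:R / 2 ^+ N :> R by rewrite divr_ge0 ?exprn_ge0.
have -> : (2 ^+ N)^-1 = i.+1%:R / 2 ^+ N - i%:R / 2 ^+ N :> R.
  by rewrite -natr1; ring.
by move=> A mA; exact: (bm_gaussian_increments bW ge0 lt mA).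
Qed.

Lemma increment_box x W N n B : brownian_motion x W ->
  (forall i, measurable (B i)) ->
  P (box (increment W N) n B) = (\prod_(i < n) P (increment W N i @^-1` B i))%E.
Proof.
move=> bW mB; pose t i : R := i%:R / 2 ^+ N.
have t0 : 0 <= t 0%N by rewrite /t mul0r.
have tS i : t i <= t i.+1 by rewrite /t ler_pM2r ?invr_gt0 ?exprn_gt0// ler_nat.
rewrite -(@bm_independent_increments _ _ _ _ _ _ bW n t t0 tS
  (fun i : 'I_n => B i) (fun i => mB i)).
congr (P _); apply/seteqP; split=> w /= h.
  by move=> i _; exact: h.
by move=> i ni; exact: (h (Ordinal ni)).
Qed.

Lemma increment_process_sigma W N n B : (forall i, measurable (B i)) ->
  process_sigma_algebra W (box (increment W N) n B).
Proof.
move=> mB; rewrite /process_sigma_algebra; set G := bigcup _ _.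
have wW t : 0 <= t -> measurable_wrt G (W t).
  move=> t0 _ C mC; apply: sub_sigma_algebra; exists t => //=.
  by exists C.
have winc i : measurable_wrt G (increment W N i).
  by apply: measurable_funB; apply: wW; rewrite divr_ge0 ?exprn_ge0.
exact: (@measurable_box _ _ (g_sigma_algebraType G)).
Qed.

Lemma planar_increments z W1 W2 N : planar_brownian_motion z W1 W2 ->
  independent_sequences P (increment W1 N) (increment W2 N).
Proof.
move=> [b1 b2 ind] a b B C mB mC; rewrite ind; last 2 first.
- exact: increment_process_sigma.
- exact: increment_process_sigma.
by rewrite (increment_box _ _ _ _ _ b1)// (increment_box _ _ _ _ _ b2).
Qed.

Lemma from_start_cvg x (z : R) W w (s : nat -> R) t : brownian_motion z W ->
  (forall n, 0 <= s n) -> s @ \oo --> t ->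
  from_start x W (s n) w @[n --> \oo] --> from_start x W t w.
Proof.
move=> bW s0 st; have t0 : 0 <= t by apply: (cvgr_to_ge st); exact: nearW.
have /subspace_continuousP/(_ t) := @bm_continuous _ _ _ _ _ _ bW w.
rewrite /= in_itv/= t0 => /(_ isT) ct.
apply: cvgD; first exact: cvg_cst.
apply: cvgB; last exact: cvg_cst.
apply: (@cvg_comp _ _ _ s (fun t => W t w) _ _ _ _ ct).
move=> A; rewrite /within/= nbhs_filterE => nA.
have := st _ nA; rewrite !near_simpl; apply: filterS => n; apply.
by rewrite in_itv/= s0.
Qed.

End Increments.

(** * Optional stopping in continuous time *)

Lemma cvg_exprn {R : realType} (u : nat -> R) (l : R) n : u @ \oo --> l ->
  (fun k => u k ^+ n) @ \oo --> l ^+ n.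
Proof.
move=> ul; elim: n => [|n IH]; first exact: cvg_cst.
by rewrite exprS; under eq_fun do rewrite exprS; exact: cvgM.
Qed.

(** For m <> 0 this is positive exactly on the hyperbolic domain; up to the
    factor m^2 - 1 it is the mean exit time. *)
Definition level {R : realType} (m b : R) (p : R * R) : R :=
  m ^+ 2 * (b ^+ 2 - p.1 ^+ 2) + p.2 ^+ 2.

Section StoppedPlanar.
Context {R : realType} {d : measure_display} {T : measurableType d}
  (P : probability T R) (m b x y : R) (W1 W2 : R -> {RV P >-> R}).
Hypothesis hW : planar_brownian_motion (x, y) W1 W2.

Definition path (w : T) (t : R) : R * R := (from_start P x W1 t w, from_start P y W2 t w).

Definition hit_time (K : nat) (w : T) : R := hit (fun t => level m b (path w t)) K.
Definition hit_fst K w : R := (path w (hit_time K w)).1.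
Definition hit_snd K w : R := (path w (hit_time K w)).2.

Let step N : R := (2 ^+ N)^-1.
Let step_gt0 N : 0 < step N. Proof. by rewrite invr_gt0 exprn_gt0. Qed.

Let xi N := increment P W1 N.
Let eta N := increment P W2 N.
Let gxi N i : is_gaussian P (Num.sqrt (step N)) (xi N i).
Proof. by apply: increment_gaussian; exact: (pbm_fst hW). Qed.
Let geta N i : is_gaussian P (Num.sqrt (step N)) (eta N i).
Proof. by apply: increment_gaussian; exact: (pbm_snd hW). Qed.
Let indep N : independent_sequences P (xi N) (eta N).
Proof. exact: planar_increments hW. Qed.

Let grid_level N k w : R := level m b (path w (k%:R / 2 ^+ N)).
Let alive N k : set T := [set w | forall i, (i <= k)%N -> 0 < grid_level N i w].

Let walkX N k w : walk x (xi N) k w = (path w (k%:R / 2 ^+ N)).1.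
Proof. exact: walk_increment. Qed.
Let walkY N k w : walk y (eta N) k w = (path w (k%:R / 2 ^+ N)).2.
Proof. exact: walk_increment. Qed.

Let aliveS N k : alive N k.+1 `<=` alive N k.
Proof. by move=> w h i ik; apply: h; exact: leqW. Qed.

(* At time k of the grid the event of not having left the domain yet depends
   only on the first k increments. *)
Let alive_past N k : <<s past (xi N) (eta N) k k >> (alive N k).
Proof.
pose T' : measurableType _ := g_sigma_algebraType (past (xi N) (eta N) k k).
have wl i : (i <= k)%N -> measurable_wrt (past (xi N) (eta N) k k) (grid_level N i).
  move=> ik; have wX : measurable_wrt (past (xi N) (eta N) k k) (walk x (xi N) i).
    by apply: walk_wrt => j ji; apply: past_xi; lia.
  have wY : measurable_wrt (past (xi N) (eta N) k k) (walk y (eta N) i).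
    by apply: walk_wrt => j ji; apply: past_eta; lia.
  have -> : grid_level N i = fun w => m ^+ 2 * (b ^+ 2 + -1 * walk x (xi N) i w ^+ 2) +
      walk y (eta N) i w ^+ 2.
    apply/funext => w; rewrite walkX walkY /grid_level /level; ring.
  by wrt.
suff H j : (j <= k)%N -> @measurable _ T' (alive N j) by exact: H.
have pos i : (i <= k)%N -> @measurable _ T' (grid_level N i @^-1` `]0, +oo[).
  by move=> ik; rewrite -[X in measurable X]setTI; exact: wl.
elim: j => [|j IH] jk.
  have -> : alive N 0 = grid_level N 0 @^-1` `]0, +oo[.
    apply/seteqP; split=> w /=; rewrite in_itv/= andbT.
      by move=> h; exact: h.
    by move=> h i; rewrite leqn0 => /eqP ->.
  exact: pos.
have -> : alive N j.+1 = alive N j `&` (grid_level N j.+1 @^-1` `]0, +oo[).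
  apply/seteqP; split=> w /=; rewrite in_itv/= andbT.
    by move=> h; split=> [i ij|]; apply: h => //; exact: leqW.
  move=> [h1 h2] i; rewrite leq_eqVlt => /predU1P[->//|]; exact: h1.
by apply: measurableI; [apply: IH; exact: ltnW|exact: pos].
Qed.

Let grid K N w : R := grid_hit (fun t => level m b (path w t)) K N.

Let stop_first_index N n w :
  stop (alive N) n w = first_index (fun i => grid_level N i w) n.
Proof.
by apply: eq_bigr => k _; congr nat_of_bool.
Qed.

Let gridE K N w : grid K N w = (stop (alive N) (K * 2 ^ N) w)%:R * step N.
Proof. by rewrite stop_first_index. Qed.

Let grid_fst K N w : (path w (grid K N w)).1 =
  walk x (xi N) (stop (alive N) (K * 2 ^ N) w) w.
Proof. by rewrite walkX gridE. Qed.
Let grid_snd K N w : (path w (grid K N w)).2 =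
  walk y (eta N) (stop (alive N) (K * 2 ^ N) w) w.
Proof. by rewrite walkY gridE. Qed.

Let s0 N : Num.sqrt (step N) != 0. Proof. by rewrite gt_eqF// sqrtr_gt0. Qed.
Let hX N k : has_moments P (walk x (xi N) k).
Proof. by apply: has_moments_walk => i; exact: (gaussian_has_moments P _ _ (s0 N)). Qed.
Let hY N k : has_moments P (walk y (eta N) k).
Proof. by apply: has_moments_walk => i; exact: (gaussian_has_moments P _ _ (s0 N)). Qed.

Let alive_measurable N k : measurable (alive N k).
Proof.
have := alive_past N k; apply: smallest_sub; first exact: sigma_algebra_measurable.
by apply: past_measurable => i; [exact: (gxi N i).1|exact: (geta N i).1].
Qed.

Let end_walk N K : (K * 2 ^ N)%:R / 2 ^+ N = K%:R :> R.
Proof. by rewrite natrM natrX mulfK// gt_eqF// exprn_gt0. Qed.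

Let grid_moments K : bounded_moments P (fun N w => grid K N w).
Proof.
apply: (bounded_moments_bounded P _ K%:R) => [N|N w]; last first.
  by rewrite ger0_norm ?grid_hit_ge0//; exact: grid_hit_le.
have -> : grid K N = fun w => (stop (alive N) (K * 2 ^ N) w)%:R * step N.
  by apply/funext => w; exact: gridE.
apply: (has_moments_measurable P).
apply: has_momentsM; last exact: has_moments_cst.
apply: (has_moments_stop P (alive N) (alive_measurable N) (aliveS N) (fun k _ => k%:R)).
by move=> k; exact: has_moments_cst.
Qed.

(* The bound, the moment of the motion at time K, does not depend on N. *)
Let fst_moments K : bounded_moments P (fun N w => (path w (grid K N w)).1).
Proof.
apply: bounded_moments_even => [N|p op].
  have -> : (fun w => (path w (grid K N w)).1) =
    fun w => walk x (xi N) (stop (alive N) (K * 2 ^ N) w) w.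
    by apply/funext => w; exact: grid_fst.
  exact: (has_moments_stop P (alive N) (alive_measurable N) (aliveS N)).
exists (\int[P]_w (path w K%:R).1 ^+ p) => N.
rewrite -(end_walk N K).
have [h _] := stopped_even_le P (xi N) (eta N) x y (step N) (step_gt0 N) (gxi N)
  (geta N) (indep N) (alive N) (alive_past N) (aliveS N) (K * 2 ^ N) p op.
apply: le_trans (le_trans _ h) _; rewrite le_eqVlt; apply/orP; left; apply/eqP.
  by apply: expect_ext => w; rewrite grid_fst.
by apply: expect_ext => w; rewrite walkX.
Qed.

Let snd_moments K : bounded_moments P (fun N w => (path w (grid K N w)).2).
Proof.
apply: bounded_moments_even => [N|p op].
  have -> : (fun w => (path w (grid K N w)).2) =
    fun w => walk y (eta N) (stop (alive N) (K * 2 ^ N) w) w.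
    by apply/funext => w; exact: grid_snd.
  exact: (has_moments_stop P (alive N) (alive_measurable N) (aliveS N)).
exists (\int[P]_w (path w K%:R).2 ^+ p) => N.
rewrite -(end_walk N K).
have [_ h] := stopped_even_le P (xi N) (eta N) x y (step N) (step_gt0 N) (gxi N)
  (geta N) (indep N) (alive N) (alive_past N) (aliveS N) (K * 2 ^ N) p op.
apply: le_trans (le_trans _ h) _; rewrite le_eqVlt; apply/orP; left; apply/eqP.
  by apply: expect_ext => w; rewrite grid_snd.
by apply: expect_ext => w; rewrite walkY.
Qed.

Lemma path_cvg w (s : nat -> R) t : (forall n, 0 <= s n) -> s @ \oo --> t ->
  (path w (s n)).1 @[n --> \oo] --> (path w t).1 /\
  (path w (s n)).2 @[n --> \oo] --> (path w t).2.
Proof.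
move=> s_ge0 st; split.
  by apply: from_start_cvg => //; exact: (pbm_fst hW).
by apply: from_start_cvg => //; exact: (pbm_snd hW).
Qed.

Lemma level_cvg b' w (s : nat -> R) t : (forall n, 0 <= s n) -> s @ \oo --> t ->
  level m b' (path w (s n)) @[n --> \oo] --> level m b' (path w t).
Proof.
move=> s_ge0 st; have [c1 c2] := path_cvg w s t s_ge0 st.
rewrite /level; apply: cvgD.
  apply: cvgM; first exact: cvg_cst.
  by apply: cvgB; [exact: cvg_cst|apply: cvgM].
by apply: cvgM.
Qed.

Let cvg_time K w : grid K N w @[N --> \oo] --> hit_time K w.
Proof. exact: grid_hit_cvg. Qed.
Let cvg_fst K w : (path w (grid K N w)).1 @[N --> \oo] --> hit_fst K w.
Proof. by apply: (path_cvg w _ _ _ (cvg_time K w)).1 => N; exact: grid_hit_ge0. Qed.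
Let cvg_snd K w : (path w (grid K N w)).2 @[N --> \oo] --> hit_snd K w.
Proof. by apply: (path_cvg w _ _ _ (cvg_time K w)).2 => N; exact: grid_hit_ge0. Qed.

Let limit_moments (F : nat -> T -> R) (f : T -> R) : bounded_moments P F ->
  (forall w, F n w @[n --> \oo] --> f w) -> has_moments P f.
Proof.
move=> bF Ff; apply: (bounded_moments_cvg P (fun n (_ : unit) => F n)) => [|_ w]; last exact: Ff.
exact: (bounded_moments_reindex P (fun p : nat * unit => p.1)).
Qed.

Lemma hit_time_moments K : has_moments P (hit_time K).
Proof. exact: limit_moments (grid_moments K) (cvg_time K). Qed.
Lemma hit_fst_moments K : has_moments P (hit_fst K).
Proof. exact: limit_moments (fst_moments K) (cvg_fst K). Qed.
Lemma hit_snd_moments K : has_moments P (hit_snd K).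
Proof. exact: limit_moments (snd_moments K) (cvg_snd K). Qed.

(** The identity holds for the stopped walk on every grid; the integrand is
    a polynomial in random variables whose moments are bounded uniformly in N. *)
Lemma optional_stopping (a : nat -> R) K :
  \int[P]_w heat_poly a (hit_time K w) (hit_fst K w) (hit_snd K w) = heat_poly a 0 x y.
Proof.
pose F N w := heat_poly a (grid K N w) (path w (grid K N w)).1 (path w (grid K N w)).2.
have bF : bounded_moments P F.
  have := grid_moments K; have := fst_moments K; have := snd_moments K.
  by move=> b1 b2 b3; rewrite /F /heat_poly; family_moments.
have cF w : F N w @[N --> \oo] --> heat_poly a (hit_time K w) (hit_fst K w) (hit_snd K w).
  have c0 := cvg_time K w; have c1 := cvg_fst K w; have c2 := cvg_snd K w.
  rewrite /F /heat_poly.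
  by repeat first [exact: cvg_cst | assumption | refine (cvg_exprn _ _ _ _) | apply: cvgD | apply: cvgN | apply: cvgM].
have EF N : \int[P]_w F N w = heat_poly a 0 x y.
  rewrite -(stopped_heat P (xi N) (eta N) x y (step N) (step_gt0 N) (gxi N)
    (geta N) (indep N) (alive N) (alive_past N) (aliveS N) a (K * 2 ^ N)).
  by apply: expect_ext => w; rewrite /F grid_fst grid_snd gridE.
have := expect_cvg P F _ bF cF; under eq_fun do rewrite EF.
by move=> h; rewrite -(cvg_lim _ h)// lim_cst.
Qed.

(** The only trace of the martingale property of the stopped second coordinate
    that is needed for its convergence in L^4. *)
Lemma hit_orthogonal K L : (K <= L)%N ->
  \int[P]_w (hit_snd K w ^+ 3 * (hit_snd L w - hit_snd K w)) = 0.
Proof.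
move=> KL; pose F N w := (path w (grid K N w)).2 ^+ 3 *
  ((path w (grid L N w)).2 - (path w (grid K N w)).2).
have bF : bounded_moments P F.
  have := snd_moments K; have := snd_moments L.
  by move=> b1 b2; rewrite /F; family_moments.
have cF w : F N w @[N --> \oo] --> hit_snd K w ^+ 3 * (hit_snd L w - hit_snd K w).
  have c1 := cvg_snd K w; have c2 := cvg_snd L w.
  apply: cvgM; last exact: cvgB.
  exact: cvg_exprn.
have EF N : \int[P]_w F N w = 0.
  have [j jE] : exists j, (L * 2 ^ N = K * 2 ^ N + j)%N.
    by exists ((L - K) * 2 ^ N)%N; rewrite -mulnDl subnKC.
  rewrite -(stopped_orthogonal P (xi N) (eta N) y (step N) (step_gt0 N) (gxi N)
    (geta N) (indep N) (alive N) (alive_past N) (aliveS N) (K * 2 ^ N) j).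
  by apply: expect_ext => w; rewrite /F !grid_snd jE.
have := expect_cvg P F _ bF cF; under eq_fun do rewrite EF.
by move=> h; rewrite -(cvg_lim _ h)// lim_cst.
Qed.

End StoppedPlanar.

(** * The polynomials of the exit time formulas *)

Definition mean_exit {R : realType} (m b : R) (p : R * R) : R :=
  (m ^+ 2 * (b ^+ 2 - p.1 ^+ 2) + p.2 ^+ 2) / (m ^+ 2 - 1).

Definition moment_ratio {R : realType} (m b : R) (p : R * R) : R :=
  (3 * (m ^+ 4 - 6 * m ^+ 2 + 1))^-1 *
   (m ^+ 2 * (m ^+ 2 - 5) / (m ^+ 2 - 1) *
      ((5 * m ^+ 2 - 1) * b ^+ 2 - (m ^+ 2 - 1) * p.1 ^+ 2) +
    (5 * m ^+ 2 - 1) * p.2 ^+ 2).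

Definition second_moment {R : realType} (m b : R) (p : R * R) : R :=
  mean_exit m b p * moment_ratio m b p.

Section ExitPolynomials.
Context {R : realType} (m b : R).
Hypothesis hm : 1 + Num.sqrt 2 < m.

(** m^4 - 6 m^2 + 1 is (m^2 - 3)^2 - 8, which vanishes at m^2 = 3 + 2 sqrt 2,
    that is, at m = 1 + sqrt 2. *)
Lemma slope_bounds : 5 < m ^+ 2 /\ 0 < m ^+ 4 - 6 * m ^+ 2 + 1.
Proof.
have s0 : 0 <= Num.sqrt 2 :> R by exact: sqrtr_ge0.
have s2 : Num.sqrt 2 ^+ 2 = 2 :> R by rewrite sqr_sqrtr.
move: (Num.sqrt 2) s0 s2 hm => s s0 s2 sm.
have s1 : 1 < s by rewrite ltNge; apply/negP => s1; nra.
have m3 : 3 + 2 * s < m ^+ 2 by nra.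
split; first by lra.
have -> : m ^+ 4 - 6 * m ^+ 2 + 1 = (m ^+ 2 - 3) ^+ 2 - 8 by ring.
by nra.
Qed.

Local Notation M := (m ^+ 2).
Let M5 : 5 < M. Proof. by case: slope_bounds. Qed.
Let D := 3 * (m ^+ 4 - 6 * m ^+ 2 + 1).
Let D0 : 0 < D. Proof. by rewrite /D mulr_gt0//; case: slope_bounds. Qed.
Let M1 : 0 < M - 1. Proof. by have := M5; lra. Qed.

Definition mean_coef : nat -> R :=
  nth 0 [:: m ^+ 2 * b ^+ 2 / (m ^+ 2 - 1); - (m ^+ 2 / (m ^+ 2 - 1)); (m ^+ 2 - 1)^-1].

Lemma heat_mean t p : heat_poly mean_coef t p.1 p.2 = mean_exit m b p + t.
Proof.
rewrite /heat_poly /mean_exit /mean_coef/=; have M1' := M1.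
by field; rewrite gt_eqF.
Qed.

(** The products of the coefficients c_i of the quadratic factor with the
    coefficients d_i of the mean, divided by the common denominator. *)
Definition second_coef : nat -> R :=
  let k := m ^+ 2 * (m ^+ 2 - 5) / (m ^+ 2 - 1) in
  let c0 := k * (5 * m ^+ 2 - 1) * b ^+ 2 in
  let c1 := - (m ^+ 2 * (m ^+ 2 - 5)) in
  let c2 := 5 * m ^+ 2 - 1 in
  let d0 := m ^+ 2 * b ^+ 2 / (m ^+ 2 - 1) in
  let d1 := - (m ^+ 2 / (m ^+ 2 - 1)) in
  let d2 := (m ^+ 2 - 1)^-1 in
  let D := 3 * (m ^+ 4 - 6 * m ^+ 2 + 1) in
  nth 0 [:: c0 * d0 / D; (c0 * d1 + c1 * d0) / D; (c0 * d2 + c2 * d0) / D;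
    c1 * d1 / D; (c1 * d2 + c2 * d1) / D; c2 * d2 / D].

Lemma heat_second t p : heat_poly second_coef t p.1 p.2 =
  second_moment m b p + 2 * (t * mean_exit m b p) + t ^+ 2.
Proof.
rewrite /heat_poly /second_moment /moment_ratio /mean_exit /second_coef/=.
have M1' := M1; have [_ D0'] := slope_bounds.
by field; rewrite !gt_eqF.
Qed.

Lemma mean_exit_ge0 p : 0 <= level m b p -> 0 <= mean_exit m b p.
Proof. by move=> p0; rewrite divr_ge0// ltW. Qed.

(** The numerator is rewritten as a combination, with nonnegative coefficients,
    of [level], b^2 and y^2. *)
Lemma moment_ratio_ge0 p : 0 <= level m b p -> 0 <= moment_ratio m b p.
Proof.
move=> p0; have m5 := M5; have m1 := M1; rewrite /moment_ratio -/D mulr_ge0 ?invr_ge0 ?(ltW D0)//.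
have pM : M * p.1 ^+ 2 <= M * b ^+ 2 + p.2 ^+ 2.
  by move: p0; rewrite /level; lra.
have -> : M * (M - 5) / (M - 1) *
    ((5 * M - 1) * b ^+ 2 - (M - 1) * p.1 ^+ 2) + (5 * M - 1) * p.2 ^+ 2 =
  (M - 5) * (M * b ^+ 2 + p.2 ^+ 2 - M * p.1 ^+ 2) +
  (M - 5) * (M - 1)^-1 * (4 * M ^+ 2 * b ^+ 2) + (4 * M + 4) * p.2 ^+ 2.
  by field; rewrite gt_eqF.
have b2 := sqr_ge0 b; have y2 := sqr_ge0 p.2; have M2 := sqr_ge0 M.
have M1i : 0 <= (M - 1)^-1 by rewrite invr_ge0 ltW.
have h1 : 0 <= (M - 5) * (M * b ^+ 2 + p.2 ^+ 2 - M * p.1 ^+ 2) by apply: mulr_ge0; lra.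
have h2 : 0 <= (M - 5) * (M - 1)^-1 * (4 * M ^+ 2 * b ^+ 2).
  by apply: mulr_ge0; apply: mulr_ge0 => //; lra.
have h3 : 0 <= (4 * M + 4) * p.2 ^+ 2 by apply: mulr_ge0 => //; lra.
by apply: addr_ge0 => //; apply: addr_ge0.
Qed.

Lemma second_moment_ge0 p : 0 <= level m b p -> 0 <= second_moment m b p.
Proof. by move=> p0; rewrite mulr_ge0 ?mean_exit_ge0 ?moment_ratio_ge0. Qed.

(** The mean and the quadratic factor are nonnegative on the domain, and the
    term in x^2 has a negative coefficient in both; dropping it bounds each of
    them by a multiple of 1 + y^2. *)
Lemma exit_polynomials_le : exists2 C, 0 < C & forall p, 0 <= level m b p ->
  [/\ mean_exit m b p <= C * (1 + p.2 ^+ 4),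
      mean_exit m b p ^+ 2 <= C * (1 + p.2 ^+ 4) &
      second_moment m b p <= C * (1 + p.2 ^+ 4)].
Proof.
have m5 := M5; have m1 := M1.
have b2 := sqr_ge0 b; have M1i : 0 < (M - 1)^-1 by rewrite invr_gt0.
have Di : 0 < D^-1 by rewrite invr_gt0.
pose A := (M * b ^+ 2 + 1) * (M - 1)^-1.
pose k := M * (M - 5) / (M - 1).
have k0 : 0 <= k by apply: mulr_ge0; [apply: mulr_ge0; lra|exact: ltW].
have Mb : 0 <= M * b ^+ 2 by apply: mulr_ge0 => //; lra.
have kb : 0 <= k * ((5 * M - 1) * b ^+ 2).
  by apply: mulr_ge0 => //; apply: mulr_ge0 => //; lra.
pose B := D^-1 * (k * ((5 * M - 1) * b ^+ 2) + (5 * M - 1)).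
have A0 : 0 < A by rewrite mulr_gt0// ltr_wpDl.
have B0 : 0 <= B.
  by apply: mulr_ge0; [exact: ltW|apply: addr_ge0 => //; lra].
exists (2 * A * (1 + A + B)) => [|p p0]; first by rewrite mulr_gt0//; lra.
have x2 := sqr_ge0 p.1; have y2 := sqr_ge0 p.2.
have uA : mean_exit m b p <= A * (1 + p.2 ^+ 2).
  rewrite /mean_exit /A [leRHS]mulrAC ler_pM2r//.
  have h1 : 0 <= M * p.1 ^+ 2 by apply: mulr_ge0 => //; lra.
  have h2 : 0 <= M * b ^+ 2 * p.2 ^+ 2 by apply: mulr_ge0.
  by lra.
have qB : moment_ratio m b p <= B * (1 + p.2 ^+ 2).
  rewrite /moment_ratio -/D /B -[leRHS]mulrA ler_pM2l// -/k.
  have h1 : 0 <= k * ((M - 1) * p.1 ^+ 2).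
    by apply: mulr_ge0 => //; apply: mulr_ge0 => //; lra.
  have h2 : 0 <= k * ((5 * M - 1) * b ^+ 2) * p.2 ^+ 2 by apply: mulr_ge0.
  by lra.
have u0 := mean_exit_ge0 p p0; have q0 := moment_ratio_ge0 p p0.
have y4 : p.2 ^+ 4 = p.2 ^+ 2 * p.2 ^+ 2 by ring.
rewrite y4; move: (p.2 ^+ 2) y2 uA qB => Y Y0 uA qB.
clearbody A B.
have s1 : 1 + Y <= 2 * (1 + Y * Y) by nra.
have s2 : (1 + Y) * (1 + Y) <= 2 * (1 + Y * Y) by have := sqr_ge0 (Y - 1); lra.
have t1 : A * 1 <= A * (1 + A + B) by rewrite ler_pM2l//; lra.
have t2 : A * A <= A * (1 + A + B) by rewrite ler_pM2l//; lra.
have t3 : A * B <= A * (1 + A + B) by rewrite ler_pM2l//; lra.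
have YY : 0 <= 1 + Y * Y by nra.
have W0 : 0 <= (1 + Y) * (1 + Y) by nra.
have key c : 0 <= c -> A * c <= A * (1 + A + B) ->
    A * c * ((1 + Y) * (1 + Y)) <= 2 * A * (1 + A + B) * (1 + Y * Y).
  move=> c0 Ac; have -> : 2 * A * (1 + A + B) * (1 + Y * Y) =
    A * (1 + A + B) * (2 * (1 + Y * Y)) by ring.
  by apply: ler_pM => //; apply: mulr_ge0 => //; exact: ltW.
split.
- apply: le_trans uA _; apply: le_trans (key 1 ler01 t1).
  by rewrite mulr1 ler_pM2l//; nra.
- apply: le_trans (key A (ltW A0) t2).
  rewrite expr2 [leRHS]mulrACA; exact: ler_pM.
- apply: le_trans (key B B0 t3).
  rewrite /second_moment [leRHS]mulrACA; exact: ler_pM.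
Qed.

End ExitPolynomials.

(** * Letting the time horizon grow *)

(** Convergence of a nonnegative sequence to 0, as a one-sided condition. *)
Definition vanishes {R : realType} (s : nat -> R) : Prop :=
  forall e, 0 < e -> exists N, forall L, (N <= L)%N -> s L <= e.

Section Vanishing.
Context {R : realType}.
Implicit Types s t : nat -> R.

Lemma vanishesD s t : vanishes s -> vanishes t -> vanishes (fun L => s L + t L).
Proof.
move=> vs vt e e0; have e2 : 0 < e / 2 by rewrite divr_gt0.
have [N HN] := vs _ e2; have [M HM] := vt _ e2.
exists (maxn N M) => L; rewrite geq_max => /andP[/HN h1 /HM h2]; lra.
Qed.

Lemma vanishesZ (c : R) s : 0 <= c -> vanishes s -> vanishes (fun L => c * s L).
Proof.
move=> c0 vs e e0; have c1 : 0 < c + 1 by lra.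
have [N HN] := vs (e / (c + 1)) (divr_gt0 e0 c1).
exists N => L /HN h; apply: le_trans (_ : c * (e / (c + 1)) <= _).
  exact: ler_wpM2l.
have e1 : 0 <= e / (c + 1) by rewrite ltW// divr_gt0.
by rewrite -[leRHS](divfK (lt0r_neq0 c1)) mulrC ler_wpM2l//; lra.
Qed.

Lemma vanishes_le s t : (forall L, (0 < L)%N -> s L <= t L) -> vanishes t -> vanishes s.
Proof.
move=> st vt e e0; have [N HN] := vt e e0; exists (maxn 1 N) => L.
by rewrite geq_max => /andP[/st h /HN]; exact: le_trans.
Qed.

Lemma vanishes_inv (c : R) : 0 <= c -> vanishes (fun L => c / L%:R).
Proof.
move=> c0 e e0; exists (Num.truncn (c / e)).+1 => L NL.
have L0 : 0 < L%:R :> R by rewrite ltr0n; exact: leq_trans NL.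
rewrite ler_pdivrMr// mulrC -ler_pdivrMr//.
have /andP[_ h] := truncn_itv (divr_ge0 c0 (ltW e0)).
by apply: le_trans (ltW h) _; rewrite ler_nat.
Qed.

End Vanishing.

Section ExpectedExit.
Context {R : realType} {d : measure_display} {T : measurableType d}
  (P : probability T R) (m b x y : R) (W1 W2 : R -> {RV P >-> R}).
Hypotheses (hW : planar_brownian_motion (x, y) W1 W2)
  (hm : 1 + Num.sqrt 2 < m) (z0 : 0 < level m b (x, y)).

Local Notation tau := (hit_time P m b x y W1 W2).
Local Notation X := (hit_fst P m b x y W1 W2).
Local Notation Y := (hit_snd P m b x y W1 W2).
Local Notation at_ K w := (path P x y W1 W2 w (tau K w)).

Let U K w := mean_exit m b (at_ K w).
Let V K w := second_moment m b (at_ K w).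
Let u := mean_exit m b (x, y).
Let v := second_moment m b (x, y).

Let hT K : has_moments P (tau K). Proof. exact: hit_time_moments hW K. Qed.
Let hX K : has_moments P (X K). Proof. exact: hit_fst_moments hW K. Qed.
Let hY K : has_moments P (Y K). Proof. exact: hit_snd_moments hW K. Qed.

Let hU K : has_moments P (U K).
Proof.
apply: (has_moments_ext P (fun w => (m ^+ 2 * (b ^+ 2 + -1 * X K w ^+ 2) + Y K w ^+ 2) *
   (m ^+ 2 - 1)^-1)); last by moments.
by move=> w; rewrite /U /mean_exit mulN1r.
Qed.

Let hV K : has_moments P (V K).
Proof.
have -> : V K = fun w => U K w * (((3 * (m ^+ 4 - 6 * m ^+ 2 + 1))^-1) *
   ((m ^+ 2 * (m ^+ 2 - 5) / (m ^+ 2 - 1)) *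
      (((5 * m ^+ 2 - 1) * b ^+ 2) + - ((m ^+ 2 - 1) * X K w ^+ 2)) +
    (5 * m ^+ 2 - 1) * Y K w ^+ 2)) by [].
by moments.
Qed.

Let start w : level m b (path P x y W1 W2 w 0) = level m b (x, y).
Proof. by rewrite /path /from_start !subrr !addr0. Qed.

Let at_level K w : (0 < K)%N -> 0 <= level m b (at_ K w) /\
  (tau K w < K%:R -> level m b (at_ K w) = 0).
Proof.
move=> K0; have lc : path_continuous (fun t => level m b (path P x y W1 W2 w t)).
  by move=> s t; exact: level_cvg hW _ _ _ _.
have l0 : 0 < level m b (path P x y W1 W2 w 0) by rewrite start.
split; first exact: (hit_ge0_value _ _ K0 lc l0).
exact: (hit_eq0 _ _ K0 lc l0).
Qed.

Let T_ge0 K w : 0 <= tau K w. Proof. exact: hit_ge0. Qed.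
Let T_le K w : tau K w <= K%:R. Proof. exact: hit_le. Qed.
Let U_ge0 K w : (0 < K)%N -> 0 <= U K w.
Proof. by move=> K0; apply: mean_exit_ge0 => //; case: (at_level K w K0). Qed.
Let V_ge0 K w : (0 < K)%N -> 0 <= V K w.
Proof. by move=> K0; apply: second_moment_ge0 => //; case: (at_level K w K0). Qed.

Let meanE K : \int[P]_w tau K w + \int[P]_w U K w = u.
Proof.
have := optional_stopping P m b x y W1 W2 hW (mean_coef m b) K.
rewrite [heat_poly _ 0 x y](heat_mean _ _ hm 0 (x, y)) addr0 -/u => <-.
rewrite -expectD//; apply: expect_ext => w.
by rewrite (heat_mean _ _ hm (tau K w) (at_ K w)) addrC.
Qed.

Let secondE K : \int[P]_w tau K w ^+ 2 + 2 * \int[P]_w (tau K w * U K w) +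
  \int[P]_w V K w = v.
Proof.
have := optional_stopping P m b x y W1 W2 hW (second_coef m b) K.
rewrite [heat_poly _ 0 x y](heat_second _ _ hm 0 (x, y)) mul0r mulr0 addr0 expr0n/= addr0 -/v => <-.
rewrite -expectZ; [|by moments]; rewrite -expectD; [|by moments|by moments].
rewrite -expectD; [|by moments|by moments]; apply: expect_ext => w.
by rewrite (heat_second _ _ hm (tau K w) (at_ K w)); rewrite -/(U K w) -/(V K w); ring.
Qed.

Let second_le K : (0 < K)%N -> \int[P]_w tau K w ^+ 2 <= v.
Proof.
move=> K0; rewrite -(secondE K) -addrA lerDl addr_ge0//.
  by rewrite mulr_ge0// expect_ge0// => w; rewrite mulr_ge0// U_ge0.
by apply: expect_ge0 => w; exact: V_ge0.
Qed.

(* The martingale Y^4 - 6 t Y^2 + 3 t^2. *)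
Let fourthE K : \int[P]_w Y K w ^+ 4 =
  y ^+ 4 + \int[P]_w (6 * (tau K w * Y K w ^+ 2) + - (3 * tau K w ^+ 2)).
Proof.
have := optional_stopping P m b x y W1 W2 hW (nth 0 [:: 0; 0; 0; 0; 0; 1]) K.
have E t p q : heat_poly (nth 0 [:: 0; 0; 0; 0; 0; 1]) t p q =
    q ^+ 4 - (6 * (t * q ^+ 2) + - (3 * t ^+ 2)) :> R.
  by rewrite /heat_poly/=; ring.
rewrite E mul0r mulr0 expr0n/= mulr0 oppr0 addr0 subr0 => <-.
rewrite (expect_ext P _ _ (fun w => E _ _ _)) expectB; [|by moments|by moments].
by rewrite subrK.
Qed.

(* 6 t q <= q^2 / 2 + 18 t^2 absorbs half of the fourth moment, and second_le
   bounds what is left. *)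
Let fourth_bound : exists B, forall K, (0 < K)%N -> \int[P]_w Y K w ^+ 4 <= B.
Proof.
exists (2 * (y ^+ 4 + 18 * v)) => K K0.
have : \int[P]_w (6 * (tau K w * Y K w ^+ 2) + - (3 * tau K w ^+ 2)) <=
    \int[P]_w (2^-1 * Y K w ^+ 4 + 18 * tau K w ^+ 2).
  apply: expect_le => [||w]; [by moments|by moments|].
  have -> : Y K w ^+ 4 = Y K w ^+ 2 * Y K w ^+ 2 by ring.
  move: (tau K w) (Y K w ^+ 2) => t q.
  by have := sqr_ge0 (6 * t - q); have := sqr_ge0 t; lra.
have -> : \int[P]_w (2^-1 * Y K w ^+ 4 + 18 * tau K w ^+ 2) =
    2^-1 * \int[P]_w Y K w ^+ 4 + 18 * \int[P]_w tau K w ^+ 2.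
  by rewrite expectD; [|by moments|by moments]; rewrite !expectZ//; moments.
have := fourthE K; have := second_le K K0; lra.
Qed.

(* The pointwise inequality (a - c)^4 <= 3 (a^4 - c^4 - 4 c^3 (a - c)), whose last
   term has expectation 0 by orthogonality; the difference of its sides is
   2 ((a - c) (a + 2 c))^2. *)
Let fourth_increment K L : (K <= L)%N ->
  \int[P]_w (Y L w + - Y K w) ^+ 4 <=
  3 * (\int[P]_w Y L w ^+ 4 - \int[P]_w Y K w ^+ 4).
Proof.
move=> KL; have orth := hit_orthogonal P m b x y W1 W2 hW K L KL.
have -> : 3 * (\int[P]_w Y L w ^+ 4 - \int[P]_w Y K w ^+ 4) =
    \int[P]_w (3 * (Y L w ^+ 4 + - Y K w ^+ 4 + - (4 * (Y K w ^+ 3 * (Y L w + - Y K w))))).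
  rewrite expectZ; [|by moments]; congr (_ * _).
  rewrite expectB; [|by moments|by moments]; rewrite expectZ; [|by moments].
  by rewrite orth mulr0 subr0 expectB; [|by moments|by moments].
apply: expect_le => [||w]; [by moments|by moments|].
move: (Y L w) (Y K w) => a c.
rewrite -subr_ge0.
have -> : 3 * (a ^+ 4 + - c ^+ 4 + - (4 * (c ^+ 3 * (a + - c)))) - (a + - c) ^+ 4 =
  2 * ((a - c) * (a + 2 * c)) ^+ 2 by ring.
by rewrite mulr_ge0 ?sqr_ge0.
Qed.

(* By fourth_increment the fourth moments increase with K, and they are bounded. *)
Let fourth_cauchy e : 0 < e -> exists2 K, (0 < K)%N & forall L, (K <= L)%N ->
  \int[P]_w Y L w ^+ 4 - \int[P]_w Y K w ^+ 4 <= e.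
Proof.
move=> e0; have [B HB] := fourth_bound.
pose S := [set \int[P]_w Y K w ^+ 4 | K in [set K | (0 < K)%N]].
have hS : has_sup S.
  split; first by exists (\int[P]_w Y 1 w ^+ 4); exists 1%N.
  by exists B => _ [K K0 <-]; exact: HB.
have [_ [K K0 <-] hK] := sup_adherent e0 hS.
exists K => // L KL; have : \int[P]_w Y L w ^+ 4 <= sup S.
  by apply: ub_le_sup; [case: hS|exists L => //; exact: leq_trans KL].
lra.
Qed.

(* The event that the domain has not been left before K; the boundary terms
   vanish outside it. *)
Let alive K : set T := [set w | tau K w = K%:R].
Let J K : T -> R := \1_(alive K).

Let malive K : measurable (alive K).
Proof.
have := has_moments_measurable P (hT K).
move=> /(_ measurableT [set K%:R] (measurable_set1 _)).
by rewrite setTI.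
Qed.

Let hJ K : has_moments P (J K). Proof. exact: has_moments_indic. Qed.

Let J01 K w : J K w = 0 \/ J K w = 1.
Proof. by rewrite /J indicE; case: (_ \in _); [right|left]. Qed.

Let J_out K w : (0 < K)%N -> J K w = 0 -> level m b (at_ K w) = 0.
Proof.
move=> K0; rewrite /J indicE; case: (boolP (w \in alive K)) => [_ /eqP|].
  by rewrite oner_eq0.
rewrite notin_setE /alive/= => h _; case: (at_level K w K0) => _; apply.
by rewrite lt_neqAle T_le andbT; apply/eqP.
Qed.

(* Markov's inequality, as E tau <= u. *)
Let J_vanishes : vanishes (fun L => \int[P]_w J L w).
Proof.
apply: (vanishes_le _ (fun L => u / L%:R)); last first.
  by apply/vanishes_inv/mean_exit_ge0 => //; exact: ltW.
move=> L L0; rewrite ler_pdivlMr ?ltr0n// mulrC -expectZ//.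
apply: (@le_trans _ _ (\int[P]_w tau L w)); last first.
  by rewrite -(meanE L) lerDl expect_ge0// => w; exact: U_ge0.
apply: expect_le => [||w]; [by moments|by moments|].
rewrite /J indicE; case: (boolP (w \in alive L)) => wL.
  by rewrite mulr1; move: wL; rewrite inE /alive/= => ->.
by rewrite mulr0.
Qed.

(* f J <= k f^2 + J / (4 k): the first term is small for small k, and then the
   second one is small for large L. *)
Let J_moment_vanishes f : has_moments P f ->
  vanishes (fun L => \int[P]_w (f w * J L w)).
Proof.
move=> hf e e0; pose F := \int[P]_w f w ^+ 2.
have F0 : 0 <= F by apply: expect_ge0 => w; exact: sqr_ge0.
pose k := e / (2 * (F + 1)).
have k0 : 0 < k by rewrite divr_gt0// mulr_gt0//; lra.
have kF : k * F <= e / 2.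
  rewrite /k; have -> : e / (2 * (F + 1)) * F = e / 2 * (F / (F + 1)).
    by field; rewrite gt_eqF//; lra.
  rewrite ler_piMr ?divr_ge0 ?(ltW e0)// ler_pdivrMr; lra.
have c0 : 0 <= (4 * k)^-1 by rewrite invr_ge0 mulr_ge0// ltW.
have e2 : 0 < e / 2 by rewrite divr_gt0.
have [N HN] := vanishesZ _ _ c0 J_vanishes _ e2.
exists N => L /HN; rewrite -expectZ// => h.
apply: (@le_trans _ _ (\int[P]_w (k * f w ^+ 2 + (4 * k)^-1 * J L w))).
  apply: expect_le => [||w]; [by moments|by moments|].
  case: (J01 L w) => ->; first by rewrite !mulr0 addr0 mulr_ge0 ?sqr_ge0// ltW.
  rewrite !mulr1 -subr_ge0.
  have -> : k * f w ^+ 2 + (4 * k)^-1 - f w = k * (f w - (2 * k)^-1) ^+ 2.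
    by field; rewrite gt_eqF.
  by rewrite mulr_ge0 ?sqr_ge0// ltW.
rewrite expectD; [|by moments|by moments].
by rewrite (expectZ P k); [rewrite -/F; lra|by moments].
Qed.

(* Y_L^4 <= 8 Y_K^4 + 8 (Y_L - Y_K)^4.  With K fixed, large, the second term is
   small for all L >= K, and the first is a fixed variable on vanishing events. *)
Let fourth_vanishes : vanishes (fun L => \int[P]_w (Y L w ^+ 4 * J L w)).
Proof.
move=> e e0; have e48 : 0 < e / 48 by rewrite divr_gt0.
have [K K0 HK] := fourth_cauchy _ e48.
have h4 : has_moments P (fun w => Y K w ^+ 4) by moments.
have e16 : 0 < e / 16 by rewrite divr_gt0.
have [N HN] := J_moment_vanishes _ h4 _ e16.
exists (maxn K N) => L; rewrite geq_max => /andP[KL NL].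
have h1 := HK L KL; have h2 := HN L NL; have h3 := fourth_increment K L KL.
apply: (@le_trans _ _ (\int[P]_w (8 * (Y K w ^+ 4 * J L w) + 8 * (Y L w + - Y K w) ^+ 4))).
  apply: expect_le => [||w]; [by moments|by moments|].
  have p4 (c : R) : 0 <= c ^+ 4 by rewrite exprn_even_ge0.
  case: (J01 L w) => ->; first by rewrite !mulr0 add0r mulr_ge0.
  rewrite !mulr1; move: (Y L w) (Y K w) => a c; rewrite -subr_ge0.
  have -> : 8 * c ^+ 4 + 8 * (a + - c) ^+ 4 - a ^+ 4 =
    (2 * c ^+ 2 - 2 * (a - c) ^+ 2) ^+ 2 + (2 * (c - (a - c)) ^+ 2) * (c + (a - c)) ^+ 2 + (c - (a - c)) ^+ 4 by ring.
  apply: addr_ge0; last exact: p4.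
  apply: addr_ge0; first exact: sqr_ge0.
  by apply: mulr_ge0; [apply: mulr_ge0 => //|]; exact: sqr_ge0.
rewrite expectD; [|by moments|by moments]; rewrite !expectZ; try by moments.
lra.
Qed.

Let growth_vanishes (F : nat -> T -> R) C : 0 <= C -> (forall K, has_moments P (F K)) ->
  (forall L w, (0 < L)%N -> F L w <= C * (1 + Y L w ^+ 4) * J L w) ->
  vanishes (fun L => \int[P]_w F L w).
Proof.
move=> C0 hF FC; have v1 := vanishesD _ _ J_vanishes fourth_vanishes.
apply: vanishes_le (vanishesZ _ _ C0 v1) => L L0.
rewrite -expectD; [|by moments|by moments]; rewrite -expectZ; [|by moments].
apply: expect_le => [||w]; [by []|by moments|].
by apply: le_trans (FC L w L0) _; rewrite le_eqVlt; apply/orP; left; apply/eqP; ring.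
Qed.

Let boundary_vanishes : [/\ vanishes (fun L => \int[P]_w U L w),
  vanishes (fun L => \int[P]_w U L w ^+ 2) & vanishes (fun L => \int[P]_w V L w)].
Proof.
have [C C0 HC] := exit_polynomials_le m b hm.
have key (f : R * R -> R) : (forall p, level m b p = 0 -> f p = 0) ->
    (forall p, 0 <= level m b p -> f p <= C * (1 + p.2 ^+ 4)) ->
    (forall K, has_moments P (fun w => f (at_ K w))) ->
    vanishes (fun L => \int[P]_w f (at_ L w)).
  move=> f0 fC hf; apply: (growth_vanishes (fun L w => f (at_ L w)) C (ltW C0)) => // L w L0.
  case: (J01 L w) => Jw; rewrite Jw.
    by rewrite mulr0 f0//; exact: J_out Jw.
  by rewrite mulr1; apply: fC; case: (at_level L w L0).
have U0 p : level m b p = 0 -> mean_exit m b p = 0.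
  by rewrite /mean_exit /level => ->; rewrite mul0r.
split.
- by apply: (key (mean_exit m b)) => // p /HC[].
- apply: (key (fun p => mean_exit m b p ^+ 2)) => [p /U0 ->|p /HC[]//|K].
    by rewrite expr0n.
  by have := hU K; rewrite /U => h; moments.
- apply: (key (second_moment m b)) => [p /U0 up|p /HC[]//|//].
  by rewrite /second_moment up mul0r.
Qed.

(* 2 t q <= k t^2 + q^2 / k, with E tau^2 bounded and E U^2 vanishing. *)
Let cross_vanishes : vanishes (fun L => \int[P]_w (tau L w * U L w)).
Proof.
have [_ vU2 _] := boundary_vanishes; move=> e e0.
have v0 : 0 <= v by apply: second_moment_ge0 => //; exact: ltW.
pose k := e / (v + 1).
have k0 : 0 < k by rewrite divr_gt0//; lra.
have kv : k * v <= e.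
  by rewrite /k mulrAC ler_pdivrMr; [rewrite ler_pM2l//; lra|lra].
have ki0 : 0 <= k^-1 by rewrite invr_ge0 ltW.
have [N HN] := vanishesZ _ _ ki0 vU2 _ e0.
exists (maxn 1 N) => L; rewrite geq_max => /andP[L0 /HN hL].
apply: (@le_trans _ _ (\int[P]_w (2^-1 * (k * tau L w ^+ 2 + k^-1 * U L w ^+ 2)))).
  apply: expect_le => [||w]; [by moments|by moments|].
  rewrite -subr_ge0.
  have -> : 2^-1 * (k * tau L w ^+ 2 + k^-1 * U L w ^+ 2) - tau L w * U L w =
    2^-1 * k^-1 * (k * tau L w - U L w) ^+ 2 by field; rewrite gt_eqF.
  by rewrite mulr_ge0 ?sqr_ge0// mulr_ge0.
rewrite expectZ; [|by moments]; rewrite expectD; [|by moments|by moments].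
rewrite !expectZ; try by moments.
have := second_le L L0; have : k * \int[P]_w tau L w ^+ 2 <= k * v.
  by rewrite ler_pM2l//; exact: second_le.
lra.
Qed.

Lemma expect_hit_time : \int[P]_w tau K w @[K --> \oo] --> u.
Proof.
have [vU _ _] := boundary_vanishes.
apply/cvgrPdist_le => e e0; have [N HN] := vU e e0.
exists (maxn 1 N) => // L; rewrite /= geq_max => /andP[L0 /HN hL].
have -> : u - \int[P]_w tau L w = \int[P]_w U L w by rewrite -(meanE L); ring.
rewrite ger0_norm//.
by apply: expect_ge0 => w; exact: U_ge0.
Qed.

Lemma expect_hit_time_sqr : \int[P]_w tau K w ^+ 2 @[K --> \oo] --> v.
Proof.
have [_ _ vV] := boundary_vanishes.
apply/cvgrPdist_le => e e0.
have [N HN] := vanishesD _ _ (vanishesZ 2 _ (ler0n _ 2) cross_vanishes) vV _ e0.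
exists (maxn 1 N) => // L; rewrite /= geq_max => /andP[L0 /HN hL].
have -> : v - \int[P]_w tau L w ^+ 2 =
    2 * \int[P]_w (tau L w * U L w) + \int[P]_w V L w by rewrite -(secondE L); ring.
rewrite ger0_norm//.
rewrite addr_ge0//.
  by rewrite mulr_ge0// expect_ge0// => w; rewrite mulr_ge0// U_ge0.
by apply: expect_ge0 => w; exact: V_ge0.
Qed.

End ExpectedExit.

(** * Exhausting the domain from inside *)

Section DiagonalLimit.
Context {R : realType}.

(** By monotonicity A n n lies between A j n, for any fixed j <= n, and l n.  It
    merges the limits in the horizon and in the domain into one. *)
Lemma diagonal_cvg (A : nat -> nat -> R) (l : nat -> R) (a : R) :
  (forall j n n', (n <= n')%N -> A j n <= A j n') ->
  (forall j j' n, (j <= j')%N -> A j n <= A j' n) ->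
  (forall j, A j @ \oo --> l j) -> l @ \oo --> a ->
  A n n @[n --> \oo] --> a.
Proof.
move=> Amono Ajmono Al la; apply/cvgrPdist_le => e e0.
have e2 : 0 < e / 2 by rewrite divr_gt0.
have /cvgrPdist_le/(_ _ e2) [J _ HJ] := la.
have /cvgrPdist_le/(_ _ e2) [N _ HN] := Al J.
exists (maxn J N) => // n; rewrite /= geq_max => /andP[Jn Nn].
have up : A n n <= l n.
  by apply: (cvgr_to_ge (Al n)); exists n => // k /= nk; exact: Amono.
have h1 := HN n Nn; have h2 := HJ n Jn; have h3 := HJ J (leqnn J).
have h4 := Ajmono J n n Jn.
move: h1 h2 h3; rewrite !ler_norml => /andP[? ?] /andP[? ?] /andP[? ?].
by apply/andP; split; lra.
Qed.

End DiagonalLimit.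

Section ExitTime.
Context {R : realType} {d : measure_display} {T : measurableType d}
  (P : probability T R) (m b x y : R) (W1 W2 : R -> {RV P >-> R}).
Hypotheses (hW : planar_brownian_motion (x, y) W1 W2)
  (hm : 1 + Num.sqrt 2 < m) (hb : 0 < b) (z0 : 0 < level m b (x, y)).

Let l0 := level m b (x, y).
Let M0 : 0 < m ^+ 2. Proof. by have [h _] := slope_bounds m hm; lra. Qed.

Let m_neq0 : m != 0.
Proof. by apply: contraTneq M0 => ->; rewrite expr0n ltxx. Qed.

(** Small enough for b - inner_gap to be positive and for the starting point to
    lie in the domain with this parameter. *)
Definition inner_gap : R := b * l0 / (l0 + 2 * b ^+ 2 * m ^+ 2).
Definition inner (n : nat) : R := b - inner_gap / n.+1%:R.

Let den0 : 0 < l0 + 2 * b ^+ 2 * m ^+ 2.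
Proof. by rewrite addr_gt0// mulr_gt0// mulr_gt0// exprn_gt0. Qed.

Let gap_gt0 : 0 < inner_gap. Proof. by rewrite divr_gt0// mulr_gt0. Qed.

Let gap_lt : inner_gap < b.
Proof.
rewrite ltr_pdivrMr// ltr_pM2l// ltrDl mulr_gt0// mulr_gt0//; exact: exprn_gt0.
Qed.

Let gap_level : 2 * b * inner_gap * m ^+ 2 < l0.
Proof.
have -> : 2 * b * inner_gap * m ^+ 2 = l0 * (2 * b ^+ 2 * m ^+ 2) / (l0 + 2 * b ^+ 2 * m ^+ 2).
  by rewrite /inner_gap; field; rewrite gt_eqF.
by rewrite ltr_pdivrMr// ltr_pM2l// ltrDr.
Qed.

Let frac n : 0 < inner_gap / n.+1%:R <= inner_gap.
Proof.
rewrite divr_gt0//= ler_pdivrMr ?ltr0n// ler_peMr ?(ltW gap_gt0)//.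
by rewrite ler1n.
Qed.

Lemma inner_lt n : 0 < inner n < b.
Proof.
have /andP[f0 f1] := frac n; have g := gap_lt.
rewrite /inner; move: (inner_gap / n.+1%:R) f0 f1 => f f0 f1.
by apply/andP; split; lra.
Qed.

Lemma inner_mono j k : (j <= k)%N -> inner j <= inner k.
Proof.
move=> jk; rewrite /inner lerD2l lerN2 ler_pM2l// lef_pV2 ?posrE ?ltr0n//.
by rewrite ler_nat.
Qed.

Lemma inner_cvg : inner @ \oo --> b.
Proof.
rewrite /inner -[X in _ --> X]subr0; apply: cvgB; first exact: cvg_cst.
rewrite -[X in _ --> X](mulr0 inner_gap); apply: cvgM; first exact: cvg_cst.
exact: cvg_harmonic.
Qed.

Lemma inner_start n : 0 < level m (inner n) (x, y).
Proof.
have /andP[f0 f1] := frac n; have g := gap_level; have gb := gap_lt.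
have -> : level m (inner n) (x, y) = l0 - m ^+ 2 * (b ^+ 2 - inner n ^+ 2).
  by rewrite /l0 /level; ring.
rewrite subr_gt0; apply: le_lt_trans g.
rewrite [leRHS]mulrC ler_pM2l// /inner.
move: (inner_gap / n.+1%:R) f0 f1 => f f0 f1.
have -> : b ^+ 2 - (b - f) ^+ 2 = 2 * b * f - f ^+ 2 by ring.
have := sqr_ge0 f; have : b * f <= b * inner_gap by rewrite ler_pM2l.
lra.
Qed.

Let raw b' (w : T) (t : R) : R := level m b' (W1 t w, W2 t w).

(** Defined from W itself rather than from the motion started exactly at
    (x, y), so that it converges to the exit time at every point of the space;
    this makes the exit time measurable without completing the measure. *)
Definition approach (n : nat) (w : T) : R := hit (raw (inner n) w) n.

Let raw_continuous b' w : path_continuous (raw b' w).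
Proof.
move=> s t s_ge0 st; have [b1 b2 _] := hW.
have c (W : R -> {RV P >-> R}) z : brownian_motion z W -> W (s n) w @[n --> \oo] --> W t w.
  move=> bW; have := from_start_cvg P (W 0 w) z W w s t bW s_ge0 st.
  by rewrite /from_start; under eq_fun do rewrite addrC subrK; rewrite addrC subrK.
have c1 := c _ _ b1; have c2 := c _ _ b2.
rewrite /raw /level; apply: cvgD; last exact: cvg_exprn.
apply: cvgM; first exact: cvg_cst.
by apply: cvgB; [exact: cvg_cst|exact: cvg_exprn].
Qed.

Lemma measurable_approach n : measurable_fun setT (approach n).
Proof.
apply: measurable_hit => t; rewrite /raw /level/=.
apply: measurable_funD; last exact: measurable_funX.
apply: measurable_funM; first exact: measurable_cst.
by apply: measurable_funB; [exact: measurable_cst|exact: measurable_funX].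
Qed.

Let level_le b1 b2 p : 0 <= b1 -> b1 <= b2 -> level m b1 p <= level m b2 p.
Proof.
move=> b10 b12; rewrite /level lerD2r ler_pM2l// lerD2r.
by rewrite lerXn2r ?nnegrE// (le_trans b10).
Qed.

Let inner_level_le j k p : (j <= k)%N -> level m (inner j) p <= level m (inner k) p.
Proof.
move=> jk; apply: level_le; last exact: inner_mono.
by have /andP[/ltW] := inner_lt j.
Qed.

Lemma approach_mono w : {homo approach ^~ w : j k / (j <= k)%N >-> j <= k}.
Proof.
move=> j k jk; apply: le_trans (hit_mono _ _ _ jk) _.
by apply: hit_le_level => t; exact: inner_level_le.
Qed.

Lemma approach_ge0 n w : 0 <= approach n w. Proof. exact: hit_ge0. Qed.

Local Notation tau := (fun w => exit_time (hyperbolic_domain m b) (fun t => (W1 t w, W2 t w))).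

Let outside w t : ~ hyperbolic_domain m b (W1 t w, W2 t w) <-> raw b w t <= 0.
Proof.
have H : hyperbolic_domain m b (W1 t w, W2 t w) <-> 0 < raw b w t.
  rewrite /hyperbolic_domain /raw /level/=; split=> h.
    have -> : m ^+ 2 * (b ^+ 2 - W1 t w ^+ 2) + W2 t w ^+ 2 =
      m ^+ 2 * (b ^+ 2 - (W1 t w ^+ 2 - W2 t w ^+ 2 / m ^+ 2)).
      by field; exact: m_neq0.
    by rewrite mulr_gt0// subr_gt0.
  rewrite -subr_gt0 -(pmulr_rgt0 _ M0).
  have -> : m ^+ 2 * (b ^+ 2 - (W1 t w ^+ 2 - W2 t w ^+ 2 / m ^+ 2)) =
     m ^+ 2 * (b ^+ 2 - W1 t w ^+ 2) + W2 t w ^+ 2 by field; exact: m_neq0.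
  by [].
rewrite H leNgt; split=> [h|/negP//]; by apply/negP.
Qed.

(** A path outside the domain with parameter b is strictly outside the one with
    parameter b_n, hence still outside at nearby dyadic times: the approximations
    stay below the exit time.  Conversely, if they converge to a finite s, then
    they are eventually below their caps, the path is outside the inner domains
    at these times, and by continuity it is outside the domain at time s. *)
Lemma approach_cvg w : (approach n w)%:E @[n --> \oo] --> tau w.
Proof.
have nd : nondecreasing_seq (fun n => (approach n w)%:E).
  by move=> j k jk; rewrite lee_fin; exact: approach_mono.
have := ereal_nondecreasing_cvgn nd; set L := ereal_sup _ => cL.
have DL n : ((approach n w)%:E <= L)%E by apply: ereal_sup_ubound; exists n.
suff -> : tau w = L by [].
apply/eqP; rewrite eq_le; apply/andP; split; last first.
  apply: le_ereal_inf_tmp => _ [t [t0 out] <-].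
  apply: ge_ereal_sup => _ [n _ <-]; rewrite lee_fin.
  apply: hit_dense => //.
  have /andP[i0 ib] := inner_lt n; have := (outside w t).1 out.
  apply: lt_le_trans; rewrite /raw /level ltrD2r ltr_pM2l// ltrD2r.
  by rewrite ltrXn2r// ?nnegrE ltW.
case: L cL DL => [s||] cL DL; last 2 first.
- exact: leey.
- by have := DL 0%N; rewrite leNgt ltNyr.
have cs : approach n w @[n --> \oo] --> s by apply: fine_cvg cL.
have s0 : 0 <= s by apply: (cvgr_to_ge cs); apply: nearW => n; exact: approach_ge0.
apply: ereal_inf_lbound; exists s => //; split=> //; apply/outside.
have c1 := raw_continuous b w (fun n => approach n w) s (fun n => approach_ge0 n w) cs.
have c2 : raw (inner n) w (approach n w) @[n --> \oo] --> raw b w s.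
  have -> : (fun n => raw (inner n) w (approach n w)) =
     (fun n => raw b w (approach n w) - m ^+ 2 * (b ^+ 2 - inner n ^+ 2)).
    by apply/funext => n; rewrite /raw /level; ring.
  rewrite -[X in _ --> X]subr0; apply: cvgB => //.
  rewrite -[X in _ --> X](mulr0 (m ^+ 2)); apply: cvgM; first exact: cvg_cst.
  rewrite -[X in _ --> X](subrr (b ^+ 2)); apply: cvgB; first exact: cvg_cst.
  by apply: cvg_exprn; exact: inner_cvg.
apply: (cvgr_to_le c2); exists (Num.truncn s).+1 => // n /= sn.
apply: hit_le0; first exact: raw_continuous.
have := DL n; rewrite lee_fin => /le_lt_trans; apply.
have /andP[_ h] := truncn_itv s0; apply: lt_le_trans h _.
by rewrite ler_nat.
Qed.

Local Notation tau_at j K := (hit_time P m (inner j) x y W1 W2 K).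

Let start_ae : {ae P, forall w n, approach n w = tau_at n n w}.
Proof.
have [b1 b2 _] := hW; have s1 := bm_start b1; have s2 := bm_start b2.
apply: filterS2 s1 s2 => w /= h1 h2 n.
rewrite /approach /hit_time; congr hit; apply/funext => t.
by rewrite /raw /path /from_start h1 h2 !(addrC _ (_ - _)) !subrK.
Qed.

Let hit_moments n : has_moments P (tau_at n n). Proof. exact: hit_time_moments hW n. Qed.

Let expect_approach n :
  (\int[P]_w (approach n w)%:E = (\int[P]_w tau_at n n w)%:E)%E.
Proof.
rewrite -(expectE P _ (hit_moments n)); apply: ae_eq_integral => //.
- by apply: measurable_EFin; exact: measurable_approach.
- by apply: measurable_EFin; exact: has_moments_measurable (hit_moments n).
- by apply: filterS start_ae => w h _; rewrite h.
Qed.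

Let expect_approach_sqr n :
  (\int[P]_w (approach n w ^+ 2)%:E = (\int[P]_w tau_at n n w ^+ 2)%:E)%E.
Proof.
have h2 : has_moments P (fun w => tau_at n n w ^+ 2) by apply: has_momentsX.
rewrite -(expectE P _ h2); apply: ae_eq_integral => //.
- by apply: measurable_EFin; apply: measurable_funX; exact: measurable_approach.
- by apply: measurable_EFin; exact: has_moments_measurable h2.
- by apply: filterS start_ae => w h _; rewrite h.
Qed.

Let cvg_mean : mean_exit m (inner n) (x, y) @[n --> \oo] --> mean_exit m b (x, y).
Proof.
have c2 : inner n ^+ 2 @[n --> \oo] --> b ^+ 2 by apply: cvg_exprn; exact: inner_cvg.
rewrite /mean_exit; apply: cvgM; last exact: cvg_cst.
apply: cvgD; last exact: cvg_cst.
apply: cvgM; first exact: cvg_cst.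
by apply: cvgB => //; exact: cvg_cst.
Qed.

Let cvg_second : second_moment m (inner n) (x, y) @[n --> \oo] --> second_moment m b (x, y).
Proof.
have c2 : inner n ^+ 2 @[n --> \oo] --> b ^+ 2 by apply: cvg_exprn; exact: inner_cvg.
rewrite /second_moment; apply: cvgM; first exact: cvg_mean.
rewrite /moment_ratio; apply: cvgM; first exact: cvg_cst.
apply: cvgD; last exact: cvg_cst.
apply: cvgM; first exact: cvg_cst.
apply: cvgB; last exact: cvg_cst.
by apply: cvgM => //; exact: cvg_cst.
Qed.

Let moments_at j K : has_moments P (tau_at j K). Proof. exact: hit_time_moments hW K. Qed.

Let tau_at_mono j K L w : (K <= L)%N -> tau_at j K w <= tau_at j L w.
Proof. exact: hit_mono. Qed.

Let tau_at_level j k K w : (j <= k)%N -> tau_at j K w <= tau_at k K w.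
Proof. by move=> jk; apply: hit_le_level => t; exact: inner_level_le. Qed.

Let tau_at_ge0 j K w : 0 <= tau_at j K w. Proof. exact: hit_ge0. Qed.

(** Monotone convergence for the increasing approximations, whose expectations
    are known in the limit. *)
Lemma exit_mean : (\int[P]_w tau w = (mean_exit m b (x, y))%:E)%E.
Proof.
have mono_conv : (\int[P]_w (approach n w)%:E @[n --> \oo] --> \int[P]_w tau w)%E.
  have := @cvg_monotone_convergence _ T R P setT measurableT (fun n w => (approach n w)%:E).
  under eq_integral do rewrite (cvg_lim _ (approach_cvg _))//.
  apply=> [n|n w _|w _ j k jk]; rewrite ?lee_fin.
  - by apply: measurable_EFin; exact: measurable_approach.
  - exact: approach_ge0.
  - exact: approach_mono.
have real_conv : ((\int[P]_w tau_at n n w)%:E @[n --> \oo] --> (mean_exit m b (x, y))%:E)%E.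
  apply: cvg_EFin; first exact: nearW.
  apply: (diagonal_cvg (fun j n => \int[P]_w tau_at j n w)
    (fun j => mean_exit m (inner j) (x, y))) => //.
  - by move=> j n n' nn; apply: expect_le => // w; exact: tau_at_mono.
  - by move=> j j' n jj; apply: expect_le => // w; exact: tau_at_level.
  - by move=> j; apply: expect_hit_time => //; exact: inner_start.
rewrite -(cvg_lim _ mono_conv)// -(cvg_lim _ real_conv)//.
by congr (limn _); apply/funext => n; exact: expect_approach.
Qed.

Lemma exit_second : (\int[P]_w (tau w ^+ 2) = (second_moment m b (x, y))%:E)%E.
Proof.
have mono_conv : (\int[P]_w (approach n w ^+ 2)%:E @[n --> \oo] --> \int[P]_w (tau w ^+ 2))%E.
  have := @cvg_monotone_convergence _ T R P setT measurableT (fun n w => (approach n w ^+ 2)%:E).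
  have sq w : ((approach n w ^+ 2)%:E @[n --> \oo] --> tau w ^+ 2)%E.
    rewrite expe2; under eq_fun do rewrite expr2 EFinM.
    apply: cvgeM; [|exact: approach_cvg|exact: approach_cvg].
    by case: (tau w) => [r||]//=; rewrite mule_def_fin.
  under eq_integral do rewrite (cvg_lim _ (sq _))//.
  apply=> [n|n w _|w _ j k jk]; rewrite ?lee_fin.
  - by apply: measurable_EFin; apply: measurable_funX; exact: measurable_approach.
  - exact: sqr_ge0.
  - by rewrite lerXn2r ?nnegrE ?approach_ge0//; exact: approach_mono.
have real_conv : ((\int[P]_w tau_at n n w ^+ 2)%:E @[n --> \oo] -->
    (second_moment m b (x, y))%:E)%E.
  have hX j K : has_moments P (fun w => tau_at j K w ^+ 2) by apply: has_momentsX.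
  apply: cvg_EFin; first exact: nearW.
  apply: (diagonal_cvg (fun j n => \int[P]_w tau_at j n w ^+ 2)
    (fun j => second_moment m (inner j) (x, y))) => //.
  - move=> j n n' nn; apply: expect_le => // w.
    by rewrite lerXn2r ?nnegrE ?tau_at_ge0//; exact: tau_at_mono.
  - move=> j j' n jj; apply: expect_le => // w.
    by rewrite lerXn2r ?nnegrE ?tau_at_ge0//; exact: tau_at_level.
  - by move=> j; apply: expect_hit_time_sqr => //; exact: inner_start.
rewrite -(cvg_lim _ mono_conv)// -(cvg_lim _ real_conv)//.
by congr (limn _); apply/funext => n; exact: expect_approach_sqr.
Qed.

End ExitTime.

Theorem lemma2p4 (R : realType) (m b : R) (hm : 1 + Num.sqrt 2 < m)
    (hb : 0 < b) (x y : R) (hxy : hyperbolic_domain m b (x, y))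
    (d : measure_display) (T : measurableType d) (P : probability T R)
    (W1 W2 : R -> {RV P >-> R})
    (hW : planar_brownian_motion (x, y) W1 W2) :
  let tau : T -> \bar R := fun w =>
    exit_time (hyperbolic_domain m b) (fun t => (W1 t w, W2 t w)) in
  (\int[P]_w (tau w ^+ 2) =
     \int[P]_w tau w *
       ((3 * (m ^+ 4 - 6 * m ^+ 2 + 1))^-1 *
        (m ^+ 2 * (m ^+ 2 - 5) / (m ^+ 2 - 1) *
           ((5 * m ^+ 2 - 1) * b ^+ 2 - (m ^+ 2 - 1) * x ^+ 2) +
         (5 * m ^+ 2 - 1) * y ^+ 2))%:E)%E /\
  (\int[P]_w tau w =
     ((m ^+ 2 * (b ^+ 2 - x ^+ 2) + y ^+ 2) / (m ^+ 2 - 1))%:E)%E.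
Proof.
have [m5 _] := slope_bounds m hm.
have z0 : 0 < level m b (x, y).
  have M0 : 0 < m ^+ 2 by lra.
  have -> : level m b (x, y) = m ^+ 2 * (b ^+ 2 - (x ^+ 2 - y ^+ 2 / m ^+ 2)).
    by rewrite /level/=; field; apply: contraTneq M0 => ->; rewrite expr0n ltxx.
  by rewrite mulr_gt0// subr_gt0.
move=> tau; have e1 := exit_mean P m b x y W1 W2 hW hm hb z0.
split; last exact: e1.
rewrite [in RHS]e1 -EFinM; exact: (exit_second P m b x y W1 W2 hW hm hb z0).
Qed.
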